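(* Let $X$ be a compact metric space and let $f:X\to X$ be a continuous transformation satisfying the specification property. If $\mu$ is an $f$-invariant, ergodic probability measure with metric entropy $h_\mu(f)>0$, then for $\mu$-almost every $x\in X$ the limits $$ \overline S(x)=\lim_{\varepsilon\to 0}\limsup_{n\to\infty}\frac1n S_n(x,\varepsilon) \quad\text{and}\quad \underline S(x)=\lim_{\varepsilon\to 0}\liminf_{n\to\infty}\frac1n S_n(x,\varepsilon) $$ exist and are both equal to $1$.
   Context: For $x\in X$, $n\ge 1$, $\varepsilon>0$ the dynamical ball is $B(x,n,\varepsilon)=\{y\in X: d(f^j(x),f^j(y))<\varepsilon \text{ for every } 0\le j\le n-1\}$. The $n$th minimal return time to the dynamical ball is $$S_n(x,\varepsilon)=\inf\{k\ge 1: f^{-k}(B(x,n,\varepsilon))\cap B(x,n,\varepsilon)\neq\emptyset\}.$$ Specification property: for every $\delta>0$ there is an integer $N=N(\delta)\ge 1$ such that for any $k\ge 1$, any points $x_1,\dots,x_k\in X$, any integers $0=a_1\le b_1<a_2\le b_2<\dots<a_k\le b_k$ satisfying $a_{i+1}-b_i>N(\delta)$, and any integer $p\ge b_k+N(\delta)$, there exists a point $x\in X$ such that $f^p(x)=x$ and $d(f^j(x),f^j(x_i))<\delta$ for every $a_i\le j\le b_i$ and $1\le i\le k$. *)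

(* Defs.v *)
From HB Require Import structures.
From mathcomp Require Export all_boot all_order all_algebra.
From mathcomp Require Export all_classical all_reals all_analysis.
Export Order.TTheory GRing.Theory Num.Theory.
Export numFieldNormedType.Exports.

Set Implicit Arguments.
Unset Strict Implicit.
Unset Printing Implicit Defensive.

Local Open Scope classical_set_scope.
Local Open Scope ring_scope.

(* Measurable types are pointed in the library, so a metric space has to be
   pointed to carry its Borel sigma-algebra. This only excludes the empty
   space, on which there is no probability measure. *)
#[short(type="pmetricType")]
HB.structure Definition PointedMetric (R : numDomainType) :=
  {X of Pointed X & Metric R X}.

Notation borel X := (g_sigma_algebraType (@open X)).

Section dynamical_balls.
Context {R : realType} {X : metricType R}.
Implicit Types (f : X -> X) (x y : X).

Definition dynamical_ball f x (n : nat) (eps : R) : set X :=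
  [set y | forall j : nat, (j < n)%N -> mdist (iter j f x) (iter j f y) < eps].

(* Extended-real valued: the infimum of the empty set is +oo. *)
Definition min_return_time f x (n : nat) (eps : R) : \bar R :=
  ereal_inf [set k%:R%:E | k in [set k : nat | (1 <= k)%N /\
    (iter k f @^-1` dynamical_ball f x n eps)
      `&` dynamical_ball f x n eps !=set0]].

(* The points x_1, ..., x_k and the times a_i, b_i are the values at 1, ..., k
   of functions on nat, whose other values play no role. *)
Definition specification f : Prop :=
  forall delta : R, 0 < delta ->
  exists2 N : nat, (1 <= N)%N &
  forall (k : nat) (x : nat -> X) (a b : nat -> nat) (p : nat),
    (1 <= k)%N ->
    a 1%N = 0%N ->
    (forall i, (1 <= i <= k)%N -> (a i <= b i)%N) ->
    (forall i, (1 <= i < k)%N -> (b i < a i.+1)%N /\ (N < a i.+1 - b i)%N) ->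
    (b k + N <= p)%N ->
  exists z : X, iter p f z = z /\
    forall i j, (1 <= i <= k)%N -> (a i <= j <= b i)%N ->
      mdist (iter j f z) (iter j f (x i)) < delta.

End dynamical_balls.

Section ergodic_theory.
Context {d : measure_display} {T : measurableType d} {R : realType}.
Implicit Types (mu : probability T R) (f : T -> T).

Definition invariant_measure mu f : Prop :=
  forall A : set T, measurable A -> mu (f @^-1` A) = mu A.

Definition ergodic_measure mu f : Prop :=
  forall A : set T, measurable A -> f @^-1` A = A -> mu A = 0%E \/ mu A = 1%E.

(* Cells are allowed to be empty; they do not contribute to the entropy. *)
Definition finite_partition (I : finType) (P : I -> set T) : Prop :=
  [/\ forall i, measurable (P i), trivIset setT P & \bigcup_i P i = setT].

(* The convention 0 log 0 = 0 is built in, since ln 0 = 0. *)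
Definition partition_entropy mu (I : finType) (P : I -> set T) : R :=
  - \sum_(i : I) fine (mu (P i)) * ln (fine (mu (P i))).

(* The partition P \/ f^-1 P \/ ... \/ f^-(n-1) P; its cells are indexed by
   itineraries of length n. *)
Definition dynamical_join f (I : finType) (P : I -> set T) (n : nat)
    (w : {ffun 'I_n -> I}) : set T :=
  \bigcap_(j : 'I_n) (iter j f @^-1` P (w j)).

(* For an invariant measure the limit exists, by subadditivity. *)
Definition entropy_of_partition mu f (I : finType) (P : I -> set T) : R :=
  limn (fun n : nat =>
    n%:R^-1 * partition_entropy mu (dynamical_join f P (n := n))).

Definition metric_entropy mu f : \bar R :=
  ereal_sup [set h : \bar R | exists (m : nat) (P : 'I_m -> set T),
    finite_partition P /\ h = (entropy_of_partition mu f P)%:E].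

End ergodic_theory.

(* Main.v *)
Require Import Defs.
From mathcomp Require Import measurable_realfun ring lra zify.

(** Upper bound: by specification, applied to the single orbit segment of [x]
    over the times [0, n], some point that follows [x] up to time [n] is
    periodic with period [n + N]. Hence [S_n(x, eps) <= n + N(eps)] for every
    [x] ([specification_return_time]).

    Lower bound: fix [theta < 1] and name the points of the space by the cells
    of a finite partition [p] of positive entropy. If the dynamical ball
    [B(x, n, eps / 2)] returns at time [k <= theta * n], then [f^j x] and
    [f^(j + k) x] are [eps]-close whenever [j + k < n]. So the first [k] letters
    of the itinerary of [x] determine its first [n] letters, except at the times
    when the orbit meets a small set [E] around the boundaries of the cells
    ([locally_constant_letter]); such times have small frequency
    ([ae_rare_visits]). A letter is compared only with the one [k] steps before
    it, so errors do not build up, however small [k] is. An itinerary that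
    repeats itself in this way can be described by little more than its first
    [theta * n] letters, which is too short a description for a typical
    itinerary of length [n] ([ae_not_repeating]).

    Descriptions are handled as subprobabilities on words: a code of length [l]
    is a weight [exp(-l)], and Kraft's inequality says that the weights of the
    words of length [n] have sum at most [1]. Two facts are needed.

    - Along almost every itinerary, no sequence of subprobabilities beats the
      measure of cylinders by an exponential factor ([ae_subprob_le], which is
      Markov's inequality with the Borel-Cantelli lemma).

    - There is a rate [c > 0] with typical cylinders of length [n] of measure
      less than [exp(-c n)] for all large [n], and a code which describes a
      typical itinerary of length [n] with weight at least [exp(-c' n)], where
      [c'] is as close to [c] as wanted.

    The second fact stands for the Shannon-McMillan-Breiman theorem. By
    ergodicity each rate [c] is almost surely slow (cylinders of measure at least
    [exp(-c n)], up to a constant factor, occur for infinitely many [n]) or almost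
    surely fast ([slow_or_fast_decay]). If [c] is slow, then most of every long
    orbit segment can be cut into blocks whose cylinders have measure at least
    [exp(-c)] to the power of their length, and concatenating the descriptions
    of the blocks yields the code, now for all large [n] ([slow_decay_code]).
    If all positive rates were slow, these codes would force the entropy of the
    partition to be zero ([word_entropy_cvg0]). Hence some rate is fast, and the
    threshold between fast and slow rates is the wanted [c] ([decay_rate]).
    The two facts contradict repetition at times [k <= theta * n], because
    [theta * c < c]. *)

Set Implicit Arguments.
Unset Strict Implicit.
Unset Printing Implicit Defensive.

Local Open Scope classical_set_scope.
Local Open Scope ring_scope.

(** * Sums over words and codes *)

Lemma sum_geometric_le (R : realType) (r : R) (N : nat) : 0 < r -> r < 1 ->
  \sum_(1 <= k < N.+1) r ^+ k <= (1 - r)^-1.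
Proof.
move=> r0 r1; rewrite -[leRHS]mul1r.
apply: le_trans (@geometric_le_lim _ N.+1 1 r _ _ _) => //; last first.
  by rewrite ger0_norm; [|exact: ltW].
rewrite /series/= [leRHS](eq_bigr (fun k => r ^+ k)); last first.
  by move=> k _; rewrite mul1r.
by rewrite [leRHS]big_ltn// lerDr.
Qed.

Section sums_over_words.
Context {R : realType} {I : finType}.
Implicit Types (F G rho : seq I -> R) (u v w : seq I).

(** The sum over the words of length [n] is a functional defined by recursion,
    rather than a sum over tuples, so that splitting words into prefixes and
    suffixes ([wsum_cat]) is an induction without casts. *)
Fixpoint wsum (n : nat) F : R :=
  if n is n'.+1 then \sum_(a : I) wsum n' (fun w => F (a :: w)) else F [::].

Lemma eq_wsum n F G :
  (forall w, size w = n -> F w = G w) -> wsum n F = wsum n G.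
Proof.
elim: n F G => [|n IH] F G FG /=; first exact: FG.
by apply: eq_bigr => a _; apply: IH => w wn; apply: FG; rewrite /= wn.
Qed.

Lemma ler_wsum n F G :
  (forall w, size w = n -> F w <= G w) -> wsum n F <= wsum n G.
Proof.
elim: n F G => [|n IH] F G FG /=; first exact: FG.
by apply: ler_sum => a _; apply: IH => w wn; apply: FG; rewrite /= wn.
Qed.

Lemma wsum_cst n c : wsum n (fun=> c) = #|I|%:R ^+ n * c.
Proof.
elim: n => [|n IH]/=; first by rewrite expr0 mul1r.
by rewrite IH sumr_const -[LHS]mulr_natl exprS mulrA.
Qed.

Lemma wsumD n F G : wsum n (fun w => F w + G w) = wsum n F + wsum n G.
Proof.
elim: n F G => //= n IH F G; rewrite -big_split/=.
by apply: eq_bigr => a _; rewrite IH.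
Qed.

Lemma wsumZ n c F : wsum n (fun w => c * F w) = c * wsum n F.
Proof.
by elim: n F => //= n IH F; rewrite mulr_sumr; apply: eq_bigr => a _.
Qed.

Lemma wsum_sum n (J : Type) (s : seq J) (F : J -> seq I -> R) :
  wsum n (fun w => \sum_(j <- s) F j w) = \sum_(j <- s) wsum n (F j).
Proof.
elim: n F => [|n IH] F //=; rewrite exchange_big/=.
by apply: eq_bigr => a _; rewrite IH.
Qed.

Lemma wsum_ge0 n F : (forall w, 0 <= F w) -> 0 <= wsum n F.
Proof.
move=> F0; rewrite -(mulr0 (#|I|%:R ^+ n)) -wsum_cst.
by apply: ler_wsum => w _.
Qed.

Lemma wsum_cat n m F :
  wsum (n + m) F = wsum n (fun u => wsum m (fun v => F (u ++ v))).
Proof. by elim: n F => //= n IH F; apply: eq_bigr => a _; rewrite IH. Qed.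

(** The form in which [dynamical_join] indexes itineraries. *)
Lemma wsum_ffun n F :
  wsum n F = \sum_(g : {ffun 'I_n -> I}) F [seq g i | i <- enum 'I_n].
Proof.
elim: n F => [|n IH] F /=.
  rewrite (big_pred1 (ffun0 (card_ord 0)))/=; last first.
    by move=> g; apply/esym/eqP/ffunP => -[].
  by rewrite (size0nil (s := enum 'I_0)) ?size_enum_ord.
under eq_bigr do rewrite IH.
rewrite pair_big/=.
pose cons_ffun (ag : I * {ffun 'I_n -> I}) : {ffun 'I_n.+1 -> I} :=
  [ffun i => oapp ag.2 ag.1 (unlift ord0 i)].
pose uncons_ffun (g : {ffun 'I_n.+1 -> I}) :=
  (g ord0, [ffun i : 'I_n => g (lift ord0 i)]).
rewrite (reindex_onto cons_ffun uncons_ffun)/=; last first.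
  move=> g _; apply/ffunP => i; rewrite ffunE/=.
  by case: unliftP => [j ->|->]/=; rewrite ?ffunE.
apply: eq_big => [[a g]/=|[a g] _/=].
  apply/esym/eqP; rewrite /uncons_ffun ffunE unlift_none/=; congr pair.
  by apply/ffunP => i; rewrite !ffunE liftK.
congr F; rewrite enum_ordSl/= ffunE unlift_none/=; congr cons.
by rewrite -map_comp; apply: eq_map => i /=; rewrite ffunE liftK.
Qed.

(** [code rho w] adds, over all the ways to cut [w] into nonempty blocks, the
    products of the weights [rho] of the blocks. The argument [k] of [code_rec]
    only bounds the depth of the recursion. *)
Fixpoint code_rec rho (k : nat) w : R :=
  if k is k'.+1 then
    if w is [::] then 1 else
    \sum_(1 <= n < (size w).+1) rho (take n w) * code_rec rho k' (drop n w)
  else 1.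

Definition code rho w := code_rec rho (size w) w.

Lemma code_recE rho k w : (size w <= k)%N -> code_rec rho k w = code rho w.
Proof.
elim/ltn_ind: k w => -[|k] IH w; first by rewrite leqn0 => /eqP/size0nil ->.
case: w => // a w wk; rewrite /code [in RHS]/=/=.
rewrite big_nat_cond [RHS]big_nat_cond; apply: eq_bigr => n /andP[/andP[n0 nw] _].
have dk : (size (drop n (a :: w)) <= size w)%N.
  by rewrite size_drop/=; lia.
congr (_ * _); rewrite IH ?(leq_trans dk)//.
by case: (ltnP (size w) k.+1) wk => // sk _; rewrite (IH (size w)).
Qed.

Lemma codeE rho w : w != [::] ->
  code rho w = \sum_(1 <= n < (size w).+1) rho (take n w) * code rho (drop n w).
Proof.
case: w => // a w _; rewrite {1}/code [LHS]/=.
rewrite big_nat_cond [RHS]big_nat_cond; apply: eq_bigr => n /andP[/andP[n0 nw] _].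
by rewrite code_recE// size_drop/=; lia.
Qed.

Lemma code_ge0 rho w : (forall u, 0 <= rho u) -> 0 <= code rho w.
Proof.
move=> rho0; rewrite /code; move: (size w) => k.
elim: k w => [|k IH] [|a w] //=; rewrite ?ler01//.
by apply: sumr_ge0 => n _; rewrite mulr_ge0.
Qed.

Lemma code_cat rho u v : (forall u, 0 <= rho u) -> u != [::] ->
  rho u * code rho v <= code rho (u ++ v).
Proof.
move=> rho0 u0; rewrite (codeE _ (w := u ++ v)); last by case: u u0.
have usz : (1 <= size u < (size (u ++ v)).+1)%N.
  by rewrite size_cat; case: u u0 => // a u _ /=; lia.
rewrite (bigD1_seq (size u)) ?mem_index_iota ?iota_uniq//=.
rewrite take_size_cat// drop_size_cat// lerDl.
by apply: sumr_ge0 => n _; rewrite mulr_ge0 ?code_ge0.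
Qed.

(** Kraft's inequality passes from blocks to their concatenations: conditioned
    on the length [k] of the first block, the words of length [n] have total
    weight at most that of the blocks of length [k]. *)
Lemma wsum_code rho n : (forall u, 0 <= rho u) ->
  (forall N, \sum_(1 <= k < N.+1) wsum k rho <= 1) -> wsum n (code rho) <= 1.
Proof.
move=> rho0 kraft; elim/ltn_ind: n => -[|n] IH; first by rewrite /= /code.
rewrite (le_trans _ (kraft n.+1))//.
under eq_wsum => w wn.
  rewrite codeE; last by rewrite -size_eq0 wn.
  rewrite wn; over.
rewrite wsum_sum; rewrite big_nat_cond [leRHS]big_nat_cond.
apply: ler_sum => k /andP[/andP[k0 kn] _].
rewrite -(subnKC (n := n.+1) (m := k))// wsum_cat.
apply: ler_wsum => u uk.
under eq_wsum do rewrite take_size_cat// drop_size_cat//.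
by rewrite wsumZ ler_piMr// IH//; lia.
Qed.

(** The weight of [v] as the continuation of a word that ends in [u], when each
    letter is drawn with weight [r] from the letter [size u] places before it:
    [u] is a sliding window. *)
Fixpoint follow (r : I -> I -> R) u v : R :=
  if v is b :: v' then r (head b u) b * follow r (rcons (behead u) b) v'
  else 1.

Lemma follow_ge0 r u v : (forall a b, 0 <= r a b) -> 0 <= follow r u v.
Proof. by move=> r0; elim: v u => //= b v IH u; rewrite mulr_ge0. Qed.

Lemma wsum_follow r n u : (0 < size u)%N -> (forall a b, 0 <= r a b) ->
  (forall a, \sum_b r a b <= 1) -> wsum n (follow r u) <= 1.
Proof.
move=> u0 r0 r1; elim: n u u0 => //= n IH [//|a u] _.
rewrite (le_trans _ (r1 a))//; apply: ler_sum => b _ /=.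
by rewrite wsumZ ler_piMr// IH// size_rcons.
Qed.

End sums_over_words.

(** * Almost sure statements and frequencies of visits *)

Section almost_everywhere_eventually.
Context {d : measure_display} {T : measurableType d} {R : realType}.
Context (mu : probability T R).

(** Almost sure eventual validity implies validity with large probability,
    because the measure is continuous along the decreasing tails. *)
Lemma ae_eventually_small (A : nat -> set T) (eta : R) :
  (forall n, measurable (A n)) ->
  {ae mu, forall x, \forall n \near \oo, A n x} -> 0 < eta ->
  \forall n \near \oo, (mu (~` A n) < eta%:E)%E.
Proof.
move=> mA aeA eta0.
have mAC n : measurable (~` A n) by exact: measurableC.
have cvgA := @lim_sup_set_cvg _ _ _ mu (fun n => ~` A n) mAC.
have sup0 : mu (lim_sup_set (fun n => ~` A n)) = 0%E.
  apply: measure_negligible.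
    apply: bigcapT_measurable => k; exact: bigcup_measurable.
  apply: negligibleS aeA => x /= io [N _ AN].
  by have [j /= Nj] := io N I; apply; apply: AN.
have {}cvgA : (mu (\bigcup_(k >= n) ~` A k) @[n --> \oo] --> 0)%E.
  rewrite -sup0; apply: cvgA.
  by rewrite (le_lt_trans (probability_le1 _ _)) ?ltry//; exact: bigcup_measurable.
have : \forall n \near \oo, (mu (\bigcup_(k >= n) ~` A k) < eta%:E)%E.
  have eta0' : (0 < eta%:E)%E by rewrite lte_fin.
  exact: (cvgA _ (open_ereal_lt' eta0')).
apply: filterS => n; apply: le_lt_trans; apply: le_measure.
- by rewrite inE.
- by rewrite inE; exact: bigcup_measurable.
- by move=> x nAx; exists n => //=.
Qed.

Lemma ae_of_measure0 (A : set T) : measurable A -> mu A = 0%E ->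
  {ae mu, forall x, ~ A x}.
Proof.
by move=> mA A0; exists A; split => // x /= /contrapT.
Qed.

Lemma ae_exists (P : T -> Prop) : {ae mu, forall x, P x} -> exists x, P x.
Proof.
move=> aeP; apply: contrapT => nP.
have : mu.-negligible (@setT T).
  by apply: negligibleS aeP => x _ Px; apply: nP; exists x.
move=> /(measure_negligible measurableT) mu0.
have := @probability_setT _ _ _ mu; rewrite [LHS]mu0 => /eqP.
by rewrite eq_sym onee_eq0.
Qed.

End almost_everywhere_eventually.

Section invariant_measures.
Context {d : measure_display} {T : measurableType d} {R : realType}.
Context (mu : probability T R) (f : T -> T).
Hypothesis measurable_f : measurable_fun setT f.
Hypothesis inv : invariant_measure mu f.

Lemma measurable_preimage A : measurable A -> measurable (f @^-1` A).
Proof. by move=> mA; rewrite -[X in measurable X]setTI; exact: measurable_f. Qed.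

Lemma measurable_iter n A : measurable A -> measurable (iter n f @^-1` A).
Proof.
move=> mA; elim: n => // n IH.
have -> : iter n.+1 f @^-1` A = f @^-1` (iter n f @^-1` A).
  by apply/seteqP; split => x /=; rewrite -iterSr.
exact: measurable_preimage.
Qed.

Lemma invariant_iter n A : measurable A -> mu (iter n f @^-1` A) = mu A.
Proof.
move=> mA; elim: n => // n IH.
have -> : iter n.+1 f @^-1` A = f @^-1` (iter n f @^-1` A).
  by apply/seteqP; split => x /=; rewrite -iterSr.
by rewrite inv//; exact: measurable_iter.
Qed.

Fixpoint visits (E : set T) (n : nat) (x : T) : nat :=
  if n is n'.+1 then (`[< E x >] + visits E n' (f x))%N else 0%N.

Lemma visitsD E m n x :
  visits E (m + n) x = (visits E m x + visits E n (iter m f x))%N.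
Proof. by elim: m x => //= m IH x; rewrite IH addnA -iterSr. Qed.

Lemma visits_le E n x : (visits E n x <= n)%N.
Proof. by elim: n x => //= n IH x; rewrite -add1n leq_add// leq_b1. Qed.

Lemma visits_mono E m n x : (m <= n)%N -> (visits E m x <= visits E n x)%N.
Proof. by move=> mn; rewrite -(subnKC mn) visitsD leq_addr. Qed.

Lemma visits_iter E n m x : (visits E n (iter m f x) <= visits E (m + n) x)%N.
Proof. by rewrite visitsD leq_addl. Qed.

Lemma measurable_visits E n (P : set nat) : measurable E ->
  measurable [set x | P (visits E n x)].
Proof.
move=> mE; elim: n P => [|n IH] P /=.
  have [P0|P0] := pselect (P 0%N).
    by rewrite [X in measurable X](_ : _ = setT)//; apply/seteqP; split.
  by rewrite [X in measurable X](_ : _ = set0)//; apply/seteqP; split.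
rewrite [X in measurable X](_ : _ =
  (E `&` f @^-1` [set y | P (1 + visits E n y)%N]) `|`
  (~` E `&` f @^-1` [set y | P (visits E n y)])).
  apply: measurableU; apply: measurableI => //; try exact: measurableC.
  - exact/measurable_preimage/(IH [set k | P (1 + k)%N]).
  - exact/measurable_preimage/IH.
apply/seteqP; split => x /=.
  by case: asboolP => [Ex|nEx] Px; [left|right].
by case: asboolP => [Ex|nEx] [] [].
Qed.

(** The elementary form of the maximal ergodic inequality. Walk along the orbit:
    at a time spent in [G], jump over the next [n] steps, which contain at least
    [c * n] visits to [E]; at any other time, advance by one. The jumps cover all
    the visits to [G], and the last one overshoots [L] by at most [N]. *)
Lemma visits_greedy E G (N : nat) (c : R) L x : 0 <= c ->
  (forall y, G y -> exists n, (1 <= n <= N)%N /\ c * n%:R <= (visits E n y)%:R) ->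
  c * (visits G L x)%:R <= (visits E (L + N) x)%:R.
Proof.
move=> c0 cover; elim/ltn_ind: L x => -[|L] IH x; first by rewrite mulr0.
have [Gx|nGx] := pselect (G x); last first.
  rewrite /= (asboolF nGx) add0n (le_trans (IH L _ _))// ler_nat.
  by rewrite leq_addl.
have [n [/andP[n0 nN] cn]] := cover x Gx.
have [Ln|nL] := leqP L.+1 n.
  rewrite (le_trans (y := c * n%:R))//.
    by rewrite ler_wpM2l// ler_nat (leq_trans (visits_le _ _ _)).
  by rewrite (le_trans cn)// ler_nat visits_mono// (leq_trans nN)// leq_addl.
rewrite -(subnKC (ltnW nL)) visitsD -addnA visitsD !natrD mulrDr lerD//.
  by rewrite (le_trans _ cn)// ler_wpM2l// ler_nat visits_le.
by apply: IH; lia.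
Qed.

Lemma visitsE E n x :
  (visits E n x)%:R%:E = (\sum_(j < n) (\1_(iter j f @^-1` E) x)%:E)%E :> \bar R.
Proof.
elim: n x => [|n IH] x; first by rewrite big_ord0.
rewrite big_ord_recl/= natrD EFinD IH; congr (_ + _)%E.
apply: eq_bigr => j _; rewrite !indicE; congr ((nat_of_bool _)%:R%:E).
by apply/idP/idP; rewrite !inE /= -iterSr.
Qed.

Lemma measurable_fun_visits E n : measurable E ->
  measurable_fun setT (fun x => (visits E n x)%:R%:E : \bar R).
Proof.
move=> mE _ B mB; rewrite setTI.
exact: (measurable_visits n [set k | B k%:R%:E] mE).
Qed.

Lemma integral_visits E n : measurable E ->
  (\int[mu]_x (visits E n x)%:R%:E = n%:R%:E * mu E)%E.
Proof.
move=> mE; under eq_integral do rewrite visitsE.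
have mEj j : measurable (iter j f @^-1` E) by exact: measurable_iter.
rewrite ge0_integral_sum//=; last first.
  by move=> j; apply/measurable_EFinP; exact: measurable_indic.
under eq_bigr do rewrite integral_indic// setIT.
rewrite (eq_bigr (fun=> mu E)); last by move=> j _; exact: invariant_iter.
rewrite -(fineK (fin_num_measure mu _ mE)) sumEFin -EFinM; congr EFin.
by rewrite sumr_const card_ord mulr_natl.
Qed.

Hypothesis erg : ergodic_measure mu f.

(** The preimages of [A] increase to a strictly invariant set of the same
    measure. *)
Lemma ergodic_zero_one A : measurable A -> A `<=` f @^-1` A ->
  {ae mu, forall x, ~ A x} \/ {ae mu, forall x, A x}.
Proof.
move=> mA Af; pose B := \bigcup_n (iter n f @^-1` A).
have mAn n : measurable (iter n f @^-1` A) by exact: measurable_iter.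
have mB : measurable B by exact: bigcupT_measurable.
have ndA : nondecreasing_seq (fun n => iter n f @^-1` A).
  by apply/nondecreasing_seqP => n; apply/subsetPset => x /= /Af.
have muB : mu B = mu A.
  have := @nondecreasing_cvg_mu _ _ _ mu _ mAn mB ndA.
  rewrite (_ : _ \o _ = cst (mu A)); last first.
    by apply/funext => n /=; exact: invariant_iter.
  by move=> /cvg_lim <-//; rewrite lim_cst.
have invB : f @^-1` B = B.
  apply/seteqP; split => x [n _ /= An].
    by exists n.+1 => //; rewrite /preimage/= -iterS iterSr.
  by exists n => //; rewrite /preimage/= -iterSr; exact: Af.
have [B0|B1] := erg mB invB; [left|right].
  by apply: ae_of_measure0; rewrite // -muB.
apply: (filterS (P := fun x => ~ (~` A) x)).
  by move=> x /= /contrapT.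
apply: ae_of_measure0; first exact: measurableC.
by rewrite probability_setC// -muB B1 subee.
Qed.

(** Occurring for infinitely many [n] up to a constant [C] is a forward invariant
    event as soon as a step along the orbit shifts [n] by one and spoils [C] by a
    bounded amount; this is the purpose of the index [C]. *)
Lemma ergodic_infinitely_often (A : nat -> nat -> set T) (K : nat) :
  (forall C n, measurable (A C n)) ->
  (forall C n x, A C n.+1 x -> A (C + K)%N n (f x)) ->
  {ae mu, forall x C, \forall n \near \oo, ~ A C n x} \/
  {ae mu, forall x, exists C, forall N, exists2 n, (N <= n)%N & A C n x}.
Proof.
move=> mA shiftA; pose Z := \bigcup_C lim_sup_set (A C).
have mZ : measurable Z.
  apply: bigcupT_measurable => C; apply: bigcapT_measurable => N.
  exact: bigcup_measurable.
have Zf : Z `<=` f @^-1` Z.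
  move=> x [C _ CZ]; exists (C + K)%N => // N _.
  have [[|n] /= Nn An] := CZ N.+1 I; first by [].
  by exists n => //=; exact: shiftA.
have [Z0|Z1] := ergodic_zero_one mZ Zf; [left|right].
- apply: filterS Z0 => x nZ C; apply: contrapT => io.
  apply: nZ; exists C => // N _; apply: contrapT => noN; apply: io.
  by exists N => // n Nn An; apply: noN; exists n.
- apply: filterS Z1 => x [C _ CZ]; exists C => N.
  by have [n] := CZ N I; exists n.
Qed.

(** A one-sided ergodic theorem. Otherwise, by ergodicity, almost every orbit
    would have arbitrarily long initial segments where [E] is visited with
    frequency about [delta]; by [visits_greedy] the mean number of visits would
    then exceed what invariance permits. The factor 4 is lost in two halvings:
    to absorb the constant [C], and because the segments have bounded length
    only on a set of measure one half. *)
Lemma ae_rare_visits E (delta : R) : measurable E ->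
  (mu E < (delta / 4)%:E)%E ->
  {ae mu, forall x, \forall n \near \oo, (visits E n x)%:R < delta * n%:R}.
Proof.
move=> mE muE.
have delta0 : 0 < delta.
  have : (0 < (delta / 4)%:E :> \bar R)%E by apply: le_lt_trans muE.
  by rewrite lte_fin; lra.
pose A C n := [set x | delta * n%:R - C%:R <= (visits E n x)%:R].
have mA C n : measurable (A C n).
  exact: (measurable_visits n [set k | delta * n%:R - C%:R <= k%:R] mE).
have shiftA C n x : A C n.+1 x -> A (C + 1)%N n (f x).
  rewrite /A /= natrD -natr1 => AC.
  suff : (`[< E x >] + visits E n (f x))%:R <= 1 + (visits E n (f x))%:R :> R.
    by nra.
  by rewrite natrD lerD2r lern1 leq_b1.
have [|often] := ergodic_infinitely_often mA shiftA.
  apply: filterS => x /(_ 0%N); apply: filterS => n.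
  by rewrite /A /= subr0 => /negP; rewrite -ltNge.
pose F M := [set x | exists n, (1 <= n <= M)%N /\
  (delta / 2) * n%:R <= (visits E n x)%:R].
have mF M : measurable (F M).
  rewrite [X in measurable X](_ : _ = \bigcup_(n in [set n | (1 <= n <= M)%N])
    [set x | (delta / 2) * n%:R <= (visits E n x)%:R]).
    apply: bigcup_measurable => n _.
    exact: (measurable_visits n [set k | delta / 2 * n%:R <= k%:R] mE).
  by apply/seteqP; split => x [n] => [[]|]; exists n.
have aeF : {ae mu, forall x, \forall M \near \oo, F M x}.
  apply: filterS often => x [C AC].
  have [n nC An] := AC (Num.trunc (2 * C%:R / delta)).+1.
  exists n => // M /= nM; exists n; split; first by rewrite nM andbT; lia.
  have : 2 * C%:R / delta <= n%:R.
    rewrite ltW// (lt_le_trans (truncnS_gt _))// ler_nat//.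
  rewrite ler_pdivrMr//; rewrite /A /= in An; lra.
have [M _ /(_ M (leqnn M)) FM] :=
  ae_eventually_small mF aeF (eta := 1/2) ltac:(lra).
have {FM} FM : ((1 / 2)%:E <= mu (F M))%E.
  move: FM; rewrite probability_setC// -(fineK (fin_num_measure mu _ (mF M))).
  by rewrite -EFinB lte_fin lee_fin; lra.
exfalso; pose e := fine (mu E).
have muEe : mu E = e%:E by rewrite /e fineK// fin_num_measure.
have eD : e < delta / 4 by rewrite -lte_fin -muEe.
have e0 : 0 <= e by rewrite -lee_fin -muEe.
have key L : delta / 4 * L%:R <= (L + M)%:R * e.
  rewrite -lee_fin [leRHS]EFinM -muEe -integral_visits//.
  apply: (@le_trans _ _
    (\int[mu]_x ((delta / 2)%:E * (visits (F M) L x)%:R%:E))%E).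
    rewrite ge0_integralZl//; last 2 first.
    - exact: measurable_fun_visits.
    - by rewrite lee_fin; lra.
    rewrite integral_visits// muleA -EFinM.
    rewrite (_ : (delta / 4 * L%:R)%:E =
                 (delta / 2 * L%:R)%:E * (1/2)%:E)%E; last first.
      by rewrite -EFinM; congr EFin; lra.
    by rewrite lee_wpmul2l// lee_fin; apply: mulr_ge0 => //; lra.
  apply: ge0_le_integral => //.
  - by move=> x _; rewrite -EFinM lee_fin; apply: mulr_ge0 => //; lra.
  - by apply: emeasurable_funM => //; exact: measurable_fun_visits.
  - exact: measurable_fun_visits.
  - move=> x _; rewrite -EFinM lee_fin; apply: visits_greedy => //; lra.
have := key (Num.trunc (M%:R * e / (delta / 4 - e))).+1.
rewrite natrD.
have := truncnS_gt (M%:R * e / (delta / 4 - e)); rewrite ltr_pdivrMr; nra.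
Qed.

End invariant_measures.

(** * Itineraries and the measure of cylinders *)

Section itineraries.
Context {d : measure_display} {T : measurableType d} {R : realType}.
Context (mu : probability T R) (f : T -> T) (I : finType) (p : T -> I).
Hypothesis measurable_f : measurable_fun setT f.
Hypothesis inv : invariant_measure mu f.
Hypothesis measurable_p : forall a, measurable (p @^-1` [set a]).

Fixpoint word (n : nat) (x : T) : seq I :=
  if n is n'.+1 then p x :: word n' (f x) else [::].

Lemma size_word n x : size (word n x) = n.
Proof. by elim: n x => //= n IH x; rewrite IH. Qed.

Lemma wordD m n x : word (m + n) x = word m x ++ word n (iter m f x).
Proof. by elim: m x => //= m IH x; rewrite IH -iterSr. Qed.

Lemma take_word k n x : (k <= n)%N -> take k (word n x) = word k x.
Proof. by move=> kn; rewrite -(subnKC kn) wordD take_size_cat ?size_word. Qed.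

Lemma drop_word k n x : (k <= n)%N ->
  drop k (word n x) = word (n - k) (iter k f x).
Proof.
by move=> kn; rewrite -{1}(subnKC kn) wordD drop_size_cat ?size_word.
Qed.

Lemma measurable_letter (P : set I) : measurable [set x | P (p x)].
Proof.
rewrite [X in measurable X](_ : _ = \bigcup_(a in P) (p @^-1` [set a])).
  by apply: fin_bigcup_measurable => // a _; exact: measurable_p.
by apply/seteqP; split => [x Px|x [a Pa /= xa]]/=; [exists (p x)|rewrite xa].
Qed.

Lemma measurable_word n (P : set (seq I)) : measurable [set x | P (word n x)].
Proof.
elim: n P => [|n IH] P /=.
  have [P0|P0] := pselect (P [::]).
    by rewrite [X in measurable X](_ : _ = setT)//; apply/seteqP; split.
  by rewrite [X in measurable X](_ : _ = set0)//; apply/seteqP; split.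
rewrite [X in measurable X](_ : _ = \bigcup_(a in setT)
   ((p @^-1` [set a]) `&` f @^-1` [set y | P (a :: word n y)])).
  apply: fin_bigcup_measurable => // a _; apply: measurableI => //.
  exact/(measurable_preimage measurable_f)/(IH [set w | P (a :: w)]).
apply/seteqP; split => [x Px|x [a _ [/= <-]]]//.
by exists (p x).
Qed.

Definition prob (A : set T) : R := fine (mu A).

Lemma probE A : measurable A -> mu A = (prob A)%:E.
Proof. by move=> mA; rewrite /prob fineK// fin_num_measure. Qed.

Lemma prob_ge0 A : 0 <= prob A.
Proof. by rewrite /prob fine_ge0. Qed.

Lemma le_prob A B : measurable A -> measurable B -> A `<=` B ->
  prob A <= prob B.
Proof.
by move=> mA mB AB; rewrite -lee_fin -!probE// le_measure ?inE.
Qed.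

Lemma prob_le1 A : measurable A -> prob A <= 1.
Proof. by move=> mA; rewrite -lee_fin -probE// probability_le1. Qed.

Lemma prob0 : prob set0 = 0.
Proof. by rewrite /prob measure0. Qed.

Lemma sum_prob_letter B k : measurable B ->
  \sum_a prob (B `&` [set x | p (iter k f x) = a]) = prob B.
Proof.
move=> mB.
have mP (P : set I) : measurable (B `&` [set x | P (p (iter k f x))]).
  apply: measurableI => //; exact: measurable_iter (measurable_letter P).
have sumP (s : seq I) : uniq s ->
    \sum_(a <- s) prob (B `&` [set x | p (iter k f x) = a]) =
    prob (B `&` [set x | p (iter k f x) \in s]).
  elim: s => [|a s IH] /=.
    move=> _; rewrite big_nil (_ : _ `&` _ = set0) ?prob0//.
    by apply/seteqP; split => x [].
  move=> /andP[nas us]; rewrite big_cons IH//.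
  apply: EFin_inj; rewrite EFinD.
  have ma := mP [set b | b = a]; have ms := mP [set b | b \in s].
  have mas := mP [set b | b \in a :: s].
  rewrite -!probE// -measureU//.
    congr (mu _); apply/seteqP; split => x /=.
      by move=> [[Bx ->]|[Bx xs]]; split => //; rewrite inE ?eqxx// xs orbT.
    by move=> [Bx]; rewrite inE => /orP[/eqP|]; [left|right].
  by apply/seteqP; split => x //= [[_ ->] [_]]; apply/negP.
rewrite -big_enum sumP ?enum_uniq//; congr prob.
by apply/seteqP; split => [x []//|x Bx]; split => //=; rewrite mem_enum.
Qed.

(** The cylinders of length [n] partition the space; the iterate of [f] is there
    to make the statement inductive. *)
Lemma wsum_prob_word B k n : measurable B ->
  wsum n (fun w => prob (B `&` [set x | word n (iter k f x) = w])) = prob B.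
Proof.
elim: n B k => [|n IH] B k mB /=.
  by congr prob; apply/seteqP; split => [x []|].
rewrite -[RHS](sum_prob_letter k mB); apply: eq_bigr => a _.
rewrite -(IH _ k.+1); last first.
  apply: measurableI => //.
  exact: (measurable_iter measurable_f _ (measurable_letter [set b | b = a])).
apply: eq_wsum => w _; congr prob; apply/seteqP; split => x /=.
  by move=> [Bx [-> <-]].
by move=> [[Bx ->] <-].
Qed.

Definition cylprob (w : seq I) : R := prob [set x | word (size w) x = w].

Lemma cylprob_ge0 w : 0 <= cylprob w. Proof. exact: prob_ge0. Qed.

Lemma wsum_cylprob n (P : set (seq I)) :
  wsum n (fun w => `[< P w >]%:R * cylprob w) = prob [set x | P (word n x)].
Proof.
rewrite -[RHS](wsum_prob_word 0 n (measurable_word n P)).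
apply: eq_wsum => w wn; rewrite /cylprob wn.
case: asboolP => Pw; rewrite ?mul1r ?mul0r.
  by congr prob; apply/seteqP; split => [x /= xw|x []]//; rewrite xw.
rewrite (_ : _ `&` _ = set0) ?prob0//.
by apply/seteqP; split => x //= [+ xw]; rewrite xw.
Qed.

Lemma wsum_cylprob1 n : wsum n cylprob = 1.
Proof.
transitivity (prob [set x | setT (word n x)]).
  by rewrite -wsum_cylprob; apply: eq_wsum => w _; rewrite asboolT// mul1r.
rewrite (_ : [set x | _] = setT); last by apply/seteqP; split.
by rewrite /prob probability_setT.
Qed.

Lemma cylprob_word n x :
  cylprob (word n x) = prob [set y | word n y = word n x].
Proof. by rewrite /cylprob size_word. Qed.

(** The cylinder of length [n + 1] of [x] lies in the preimage of the cylinder of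
    length [n] of [f x], which has the measure of the latter by invariance. *)
Lemma cylprob_shift n x : cylprob (word n.+1 x) <= cylprob (word n (f x)).
Proof.
rewrite !cylprob_word {2}/prob -inv; last first.
  exact: (measurable_word n [set w | w = word n (f x)]).
apply: le_prob.
- exact: (measurable_word n.+1 [set w | w = word n.+1 x]).
- apply: (measurable_preimage measurable_f).
  exact: (measurable_word n [set w | w = word n (f x)]).
- by move=> y /= [_ ->].
Qed.

(** The words of length [n] with [Q n w > exp(a n) * cylprob w] have total measure
    at most [exp(- a n)], which is summable. *)
Lemma ae_subprob_le (Q : nat -> seq I -> R) (a : R) :
  (forall n w, 0 <= Q n w) -> (forall n, wsum n (Q n) <= 1) -> 0 < a ->
  {ae mu, forall x, \forall n \near \oo,
    Q n (word n x) <= expR (a * n%:R) * cylprob (word n x)}.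
Proof.
move=> Q0 Q1 a0.
pose A n := [set x | expR (a * n%:R) * cylprob (word n x) < Q n (word n x)].
have mA n : measurable (A n).
  exact: (measurable_word n [set w | expR (a * n%:R) * cylprob w < Q n w]).
have muA n : prob (A n) <= expR (- a) ^+ n.
  rewrite /A -(wsum_cylprob n [set w | expR (a * n%:R) * cylprob w < Q n w]).
  rewrite -expRM_natr mulNr -[leRHS]mulr1.
  rewrite (le_trans _ (ler_wpM2l (expR_ge0 _) (Q1 n)))// -wsumZ.
  apply: ler_wsum => w _; case: asboolP => /= [Qw|_].
    by rewrite expRN mul1r ler_pdivlMl ?expR_gt0// ltW.
  by rewrite mul0r mulr_ge0 ?expR_ge0.
have : mu (lim_sup_set A) = 0%E.
  apply: lim_sup_set_cvg0 => //.
  have r1 : `|expR (- a)| < 1 :> R by rewrite ger0_norm ?expR_ge0// expR_lt1; lra.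
  apply: (@le_lt_trans _ _ (\sum_(n <oo) (geometric 1 (expR (- a)) n)%:E)%E).
    apply: lee_nneseries => n _; first by rewrite measure_ge0.
    by rewrite /geometric/= mul1r; move: (muA n); rewrite -lee_fin -probE.
  apply: (@le_lt_trans _ _ (1 / (1 - expR (- a)))%:E); last exact: ltry.
  apply: lime_le.
    apply: is_cvg_nneseries => n _ _.
    by rewrite lee_fin /= mulr_ge0 ?exprn_ge0 ?expR_ge0.
  apply: nearW => n; rewrite sumEFin lee_fin.
  by have := @geometric_le_lim _ n 1 (expR (- a)); apply; rewrite ?expR_gt0.
have mlim : measurable (lim_sup_set A).
  by apply: bigcapT_measurable => N; exact: bigcup_measurable.
move=> /(ae_of_measure0 mlim); apply: filterS => x nA.
apply: contrapT => io; apply: nA => N _; apply: contrapT => noN; apply: io.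
exists N => // n Nn /=; rewrite leNgt; apply/negP => An.
by apply: noN; exists n.
Qed.

End itineraries.

(** * Exponential decay of cylinders *)

Section decay.
Context {d : measure_display} {T : measurableType d} {R : realType}.
Context (mu : probability T R) (f : T -> T) (I : finType) (p : T -> I).
Hypothesis measurable_f : measurable_fun setT f.
Hypothesis inv : invariant_measure mu f.
Hypothesis measurable_p : forall a, measurable (p @^-1` [set a]).
Local Notation word := (word f p).
Local Notation cylprob := (cylprob mu f p).
Local Notation prob := (prob mu).

(** The factor [exp(- C)] absorbs the change of [n] by one when [x] moves one step
    along its orbit. *)
Definition slow_decay (c : R) (x : T) := exists C : nat, forall N : nat,
  exists2 n, (N <= n)%N & expR (- (c * n%:R) - C%:R) <= cylprob (word n x).

Definition fast_decay (c : R) (x : T) := forall C : nat,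
  \forall n \near \oo, ~ expR (- (c * n%:R) - C%:R) <= cylprob (word n x).

Lemma slow_decay_le c c' x : c <= c' -> slow_decay c x -> slow_decay c' x.
Proof.
move=> cc' [C slowC]; exists C => N; have [n Nn cn] := slowC N; exists n => //.
by rewrite (le_trans _ cn)// ler_expR lerB// lerN2 ler_wpM2r.
Qed.

Lemma slow_fast_decay c x : slow_decay c x -> fast_decay c x -> False.
Proof.
move=> [C slowC] /(_ C)[N _ fastN]; have [n Nn cn] := slowC N.
exact: fastN cn.
Qed.

(** The uniform distribution on words gives weight [#|I|^-n] to each of them, so
    cylinders cannot decay faster than that by an exponential factor. *)
Lemma slow_decay_large : exists c, {ae mu, forall x, slow_decay c x}.
Proof.
have I0 : (0 < #|I|)%N by apply/card_gt0P; exists (p point).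
pose Q n (w : seq I) : R := #|I|%:R ^- n.
exists (1 + ln #|I|%:R).
have : {ae mu, forall x, \forall n \near \oo,
    Q n (word n x) <= expR (1 * n%:R) * cylprob (word n x)}.
  apply: ae_subprob_le => // n; first by move=> w; rewrite /Q invr_ge0 exprn_ge0.
  by rewrite wsum_cst mulfV// expf_neq0// pnatr_eq0 -lt0n.
apply: filterS => x [N _ QN]; exists 0%N => M; exists (maxn M N).
  exact: leq_maxl.
have /= := QN (maxn M N) (leq_maxr _ _).
set n := maxn M N; rewrite /Q -ler_pdivrMl ?expR_gt0// -expRN.
apply: le_trans; rewrite subr0 mulrDl opprD expRD ler_wpM2l ?expR_ge0//.
by rewrite expRN expRM_natr lnK ?posrE ?ltr0n.
Qed.

(** The code behind [slow_decay_code]. A block is a single letter, of weight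
    [exp(- B) = 1 / (2 #|I|)], or any word [u], of weight almost [cylprob u]: the
    factor [kappa * r ^ size u] makes the sum over all lengths at most one half,
    and with [r] close to 1 it costs an arbitrarily small exponential rate. *)
Section slow_decay_code.
Variables (r kappa B : R).
Hypotheses (r_gt0 : 0 < r) (r_lt1 : r < 1).
Hypothesis B_def : expR (- B) = (2 * #|I|%:R)^-1.
Hypothesis kappa_def : kappa = (1 - r) / 2.
Hypothesis B0 : 0 <= B.

Definition block_weight (u : seq I) : R :=
  expR (- B) * (size u == 1)%:R + kappa * r ^+ size u * cylprob u.

Let kappa0 : 0 < kappa. Proof. by rewrite kappa_def; move: r_lt1; lra. Qed.

Let kr0 n : 0 <= kappa * r ^+ n.
Proof. by rewrite mulr_ge0// ?exprn_ge0// ltW. Qed.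

Lemma block_weight_ge0 u : 0 <= block_weight u.
Proof.
by rewrite addr_ge0// mulr_ge0 ?expR_ge0 ?cylprob_ge0.
Qed.

Lemma block_weight_kraft N : \sum_(1 <= k < N.+1) wsum k block_weight <= 1.
Proof.
have I0 : (0 < #|I|)%N by apply/card_gt0P; exists (p point).
have wk k : wsum k block_weight = (k == 1)%:R / 2 + kappa * r ^+ k.
  under eq_wsum => w wk do rewrite /block_weight wk.
  rewrite wsumD wsum_cst wsumZ wsum_cylprob1// mulr1; congr (_ + _).
  have [->|_] := eqVneq k 1; last by rewrite mulr0 mulr0 mul0r.
  rewrite expr1 B_def mulr1 invfM mulrCA mulfV ?mulr1 ?mul1r//.
  by rewrite pnatr_eq0 -lt0n.
under eq_bigr do rewrite wk.
rewrite big_split/= -mulr_suml -mulr_sumr.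
rewrite [leRHS](_ : 1 = 1 / 2 + 1 / 2); last by lra.
apply: lerD.
  rewrite ler_wpM2r ?invr_ge0//.
  case: N => [|N]; first by rewrite big_geq.
  by rewrite big_nat_recl// big_nat_cond big1 ?addr0// => -[|i] // /andP[].
have := sum_geometric_le N r_gt0 r_lt1.
move/(ler_wpM2l (ltW kappa0)) => /le_trans; apply.
rewrite kappa_def mulrAC mulfV//.
by rewrite subr_eq0 eq_sym lt_eqF.
Qed.

Lemma code_ge_expR w : expR (- (B * (size w)%:R)) <= code block_weight w.
Proof.
elim: w => [|a w IH]; first by rewrite mulr0 oppr0 expR0.
have := @code_cat _ _ block_weight [:: a] w block_weight_ge0 isT.
apply: le_trans.
rewrite /= -nat1r mulrDr mulr1 opprD expRD ler_pM ?expR_ge0//.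
by rewrite /block_weight/= mulr1 lerDl mulr_ge0 ?cylprob_ge0.
Qed.

(** At such points the code can take a block at a cost of [c] per letter. *)
Definition heavy_block (c : R) (M : nat) : set T := [set x | exists n,
  (1 <= n <= M)%N /\ expR (- (c * n%:R)) <= kappa * r ^+ n * cylprob (word n x)].

Lemma measurable_heavy_block c M : measurable (heavy_block c M).
Proof.
rewrite [X in measurable X](_ : _ = \bigcup_(n in [set n | (1 <= n <= M)%N])
  [set x | expR (- (c * n%:R)) <= kappa * r ^+ n * cylprob (word n x)]).
  apply: bigcup_measurable => n _.
  exact: (measurable_word measurable_f measurable_p n
    [set w | expR (- (c * n%:R)) <= kappa * r ^+ n * cylprob w]).
by apply/seteqP; split => x [n] => [[]|]; exists n.
Qed.

(** Cut the itinerary greedily: from a heavy point take a heavy block, from any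
    other point take a single letter, at an extra cost [B]. The last [M] letters
    may all be single, since a heavy block may not fit there. *)
Lemma code_word_ge c M n x : 0 <= c ->
  expR (- (c * n%:R + B * (visits f (~` heavy_block c M) n x + M)%:R)) <=
  code block_weight (word n x).
Proof.
move=> c0; elim/ltn_ind: n x => n IH x.
have [nM|Mn] := leqP n M.
  rewrite (le_trans _ (code_ge_expR _))// ler_expR lerN2 size_word.
  have : n%:R <= (visits f (~` heavy_block c M) n x + M)%:R :> R.
    by rewrite ler_nat (leq_trans nM)// leq_addl.
  by move=> /(ler_wpM2l B0)/le_trans; apply; rewrite lerDr mulr_ge0.
have [[k [/andP[k0 kM] kx]]|nG] := pselect (heavy_block c M x).
  have kn : (k <= n)%N by lia.
  rewrite -{3}(subnKC kn) wordD.
  have := code_cat (u := word k x) (word (n - k) (iter k f x)) block_weight_ge0.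
  rewrite -size_eq0 size_word -lt0n => /(_ k0); apply: le_trans.
  apply: (@le_trans _ _ (expR (- (c * k%:R)) * expR (- (c * (n - k)%:R +
      B * (visits f (~` heavy_block c M) (n - k) (iter k f x) + M)%:R)))).
    rewrite -expRD ler_expR -opprD lerN2 addrA -mulrDr -natrD subnKC//.
    rewrite lerD2l ler_wpM2l// ler_nat leq_add2r.
    by rewrite -{2}(subnKC kn) visits_iter.
  apply: ler_pM; rewrite ?expR_ge0//; last by apply: IH; lia.
  rewrite (le_trans kx)// /block_weight size_word lerDr.
  by rewrite mulr_ge0 ?expR_ge0.
case: n Mn IH => // n Mn IH.
have := @code_cat _ _ block_weight [:: p x] (word n (f x)) block_weight_ge0 isT.
apply: le_trans.
apply: (@le_trans _ _ (expR (- B) * expR (- (c * n%:R +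
      B * (visits f (~` heavy_block c M) n (f x) + M)%:R)))).
  rewrite -expRD ler_expR -opprD lerN2 /= asboolT// -addnA add1n -!nat1r.
  by rewrite !mulrDr !mulr1; lra.
rewrite ler_pM ?expR_ge0//; last exact: IH.
by rewrite /block_weight/= mulr1 lerDl mulr_ge0 ?cylprob_ge0.
Qed.

End slow_decay_code.

Hypothesis erg : ergodic_measure mu f.

Lemma slow_or_fast_decay c :
  {ae mu, forall x, slow_decay c x} \/ {ae mu, forall x, fast_decay c x}.
Proof.
pose A C n := [set x | expR (- (c * n%:R) - C%:R) <= cylprob (word n x)].
have mA C n : measurable (A C n).
  exact: (measurable_word measurable_f measurable_p n
    [set w | expR (- (c * n%:R) - C%:R) <= cylprob w]).
pose K := (Num.trunc c).+1.
have cK : c <= K%:R by rewrite ltW// truncnS_gt.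
have shiftA C n x : A C n.+1 x -> A (C + K)%N n (f x).
  rewrite /A /= => AC.
  have := cylprob_shift measurable_f inv measurable_p n x.
  apply: le_trans; apply: le_trans AC; rewrite ler_expR natrD -natr1 mulrDr.
  by lra.
have [fast|slow] := ergodic_infinitely_often measurable_f inv erg mA shiftA.
- by right.
- by left.
Qed.

(** Almost every point starts a heavy block of some length; with blocks of length
    at most [M], for large [M], the exceptional points are so rare that the single
    letters cost little. The cylinders are heavy only for infinitely many lengths,
    while the code is efficient for all large lengths. *)
Lemma slow_decay_code c c' : 0 <= c -> c < c' ->
  {ae mu, forall x, slow_decay c x} ->
  exists (q : seq I -> R) (B : R),
  [/\ forall w, expR (- (B * (size w)%:R)) <= q w,
      forall n, wsum n q <= 1 &
      {ae mu, forall x, \forall n \near \oo,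
        expR (- (c' * n%:R)) <= q (word n x)}].
Proof.
move=> c0 cc' slow.
have I0 : (0 < #|I|)%N by apply/card_gt0P; exists (p point).
have I1 : 1 <= #|I|%:R :> R by rewrite ler1n.
(* The gap between [c] and [c'] pays, by quarters: the factor [r], the constants
   [kappa] and [C], the single letters, and the last [M] letters. *)
pose delta := (c' - c) / 4.
have delta0 : 0 < delta by rewrite /delta; lra.
pose r := expR (- delta); pose kappa := (1 - r) / 2.
pose B := ln (2 * #|I|%:R : R).
have r_gt0 : 0 < r by rewrite expR_gt0.
have r_lt1 : r < 1 by rewrite expR_lt1 oppr_lt0.
have kappa0 : 0 < kappa by rewrite /kappa; lra.
have B_def : expR (- B) = (2 * #|I|%:R)^-1 by rewrite expRN lnK// posrE; lra.
have B0 : 0 <= B by rewrite ln_ge0//; lra.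
exists (code (block_weight r kappa B)), B; split.
- exact: code_ge_expR.
- move=> n; apply: wsum_code => [u|N]; first exact: block_weight_ge0.
  exact: block_weight_kraft.
have aeG : {ae mu, forall x, \forall M \near \oo,
    heavy_block r kappa (c + 2 * delta) M x}.
  apply: filterS slow => x [C slowC].
  have [n nC An] := slowC (Num.trunc ((C%:R - ln kappa) / delta)).+1.
  exists n => // M /= nM; exists n; split; first by rewrite nM andbT; lia.
  have : (C%:R - ln kappa) / delta <= n%:R.
    by rewrite ltW// (lt_le_trans (truncnS_gt _))// ler_nat.
  rewrite ler_pdivrMr// => nCk.
  apply: (@le_trans _ _ (kappa * r ^+ n * expR (- (c * n%:R) - C%:R))).
    rewrite -{1}(lnK (x := kappa))// -expRM_natr -!expRD ler_expR.
    by rewrite mulrDl; lra.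
  by rewrite ler_wpM2l// mulr_ge0 ?exprn_ge0 ?ltW//; lra.
pose eta := delta / (B + 1).
have eta0 : 0 < eta by rewrite divr_gt0//; lra.
have [M _ /(_ M (leqnn M)) muG] :=
  ae_eventually_small (measurable_heavy_block r kappa (c + 2 * delta)) aeG
    (eta := eta / 4) ltac:(lra).
have := ae_rare_visits measurable_f inv erg
  (measurableC (measurable_heavy_block r kappa (c + 2 * delta) M)) muG.
apply: filterS => x [N _ rareN].
exists (maxn N (Num.trunc (B * M%:R / delta)).+1) => // n /=.
rewrite geq_max => /andP[Nn Mn].
have c2 : 0 <= c + 2 * delta by lra.
apply: (le_trans _ (code_word_ge r_gt0 r_lt1 erefl B0 M n x c2)).
have BM : B * M%:R <= delta * n%:R.
  rewrite [leRHS]mulrC -ler_pdivrMr// ltW// (lt_le_trans (truncnS_gt _))//.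
  by rewrite ler_nat.
have /= := rareN n Nn; rewrite ler_expR lerN2 natrD.
set V := (visits _ _ _ _)%:R => Vn.
have BV : B * V <= delta * n%:R.
  apply: (@le_trans _ _ (B * (eta * n%:R))); first by rewrite ler_wpM2l// ltW.
  rewrite mulrA ler_wpM2r// /eta mulrCA ger_pMr// ler_pdivrMr; lra.
have -> : c' = c + 4 * delta by rewrite /delta; lra.
by rewrite !mulrDl mulrDr; lra.
Qed.

End decay.

(** * Entropy *)

Section entropy.
Context {d : measure_display} {T : measurableType d} {R : realType}.
Context (mu : probability T R) (f : T -> T) (I : finType) (p : T -> I).
Hypothesis measurable_f : measurable_fun setT f.
Hypothesis inv : invariant_measure mu f.
Hypothesis measurable_p : forall a, measurable (p @^-1` [set a]).
Local Notation word := (word f p).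
Local Notation cylprob := (cylprob mu f p).
Local Notation prob := (prob mu).

Definition word_entropy n : R := - wsum n (fun w => cylprob w * ln (cylprob w)).

Lemma dynamical_join_word n (g : {ffun 'I_n -> I}) :
  dynamical_join f (fun a => p @^-1` [set a]) g =
  [set x | word n x = [seq g i | i <- enum 'I_n]].
Proof.
have wordE x : word n x = [seq p (iter (nat_of_ord i) f x) | i <- enum 'I_n].
  rewrite (map_comp (fun j => p (iter j f x)) (@nat_of_ord n)) val_enum_ord.
  elim: n x {g} => // n IH x; rewrite [LHS]/= IH /= (iotaDl 1 0) -map_comp.
  by congr cons; apply: eq_map => j /=; rewrite -iterS iterSr.
apply/seteqP; split => x /= xg.
  by rewrite wordE; apply: eq_map => i; have := xg i Logic.I.
move=> i _; move: xg; rewrite wordE => /eq_in_map; apply.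
by rewrite mem_enum.
Qed.

Lemma partition_entropy_word n :
  partition_entropy mu (dynamical_join f (fun a => p @^-1` [set a]) (n := n)) =
  word_entropy n.
Proof.
rewrite /partition_entropy /word_entropy wsum_ffun; congr (- _).
apply: eq_bigr => g _; rewrite dynamical_join_word /cylprob.
by rewrite size_map size_enum_ord.
Qed.

Lemma word_entropy_ge0 n : 0 <= word_entropy n.
Proof.
rewrite /word_entropy -mulN1r -wsumZ; apply: wsum_ge0 => w.
rewrite mulN1r -mulrN mulr_ge0 ?cylprob_ge0// oppr_ge0 ln_le0//.
apply: prob_le1.
exact: (measurable_word measurable_f measurable_p (size w) [set v | v = w]).
Qed.

(** Gibbs' inequality. *)
Lemma word_entropy_le n (q : seq I -> R) : (forall w, 0 < q w) ->
  wsum n q <= 1 -> word_entropy n <= wsum n (fun w => cylprob w * - ln (q w)).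
Proof.
move=> q0 q1; have : wsum n (fun w => - (cylprob w * ln (cylprob w))) <=
    wsum n (fun w => cylprob w * - ln (q w) + (q w + -1 * cylprob w)).
  apply: ler_wsum => w _.
  have := cylprob_ge0 mu f p w; rewrite le_eqVlt => /orP[/eqP <-|m0].
    by rewrite !mul0r mulr0 oppr0 add0r addr0 ltW.
  have := @le_ln1Dx R (q w / cylprob w - 1).
  rewrite [1 + _]addrC subrK ltrBrDr addNr divr_gt0// => /(_ isT).
  rewrite ln_div ?posrE// => /(ler_wpM2l (ltW m0)).
  rewrite mulrBr mulrBr mulr1 [_ * (_ / _)]mulrCA mulfV ?gt_eqF// mulr1.
  by lra.
rewrite !wsumD wsumZ wsum_cylprob1//.
rewrite -(eq_wsum (F := fun w => -1 * (cylprob w * ln (cylprob w)))); last first.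
  by move=> w _; rewrite mulN1r.
by rewrite wsumZ mulN1r /word_entropy; lra.
Qed.

Hypothesis erg : ergodic_measure mu f.

(** Use as [q] in [word_entropy_le] the code of a small rate. Its weights are never
    less than [exp(- B n)], so the words of small probability on which the rate
    fails contribute little. *)
Lemma word_entropy_cvg0 :
  (forall c, 0 < c -> {ae mu, forall x, slow_decay mu f p c x}) ->
  (fun n => n%:R^-1 * word_entropy n) @ \oo --> 0.
Proof.
move=> slow; apply/cvgrPdist_le => e e0.
have e4 : 0 < e / 4 by lra.
have [q [B [q_ge q1 aeq]]] := slow_decay_code (c' := e / 2) measurable_f inv
  measurable_p erg (ltW e4) ltac:(lra) (slow _ e4).
have q0 w : 0 < q w by rewrite (lt_le_trans _ (q_ge w))// expR_gt0.
pose A n := [set x | expR (- (e / 2 * n%:R)) <= q (word n x)].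
have mA n : measurable (A n).
  exact: (measurable_word measurable_f measurable_p n
    [set w | expR (- (e / 2 * n%:R)) <= q w]).
have eB0 : 0 < e / 2 / (`|B| + 1) by rewrite !divr_gt0// ltr_wpDl.
have := ae_eventually_small mA aeq eB0.
apply: filterS => n; rewrite (probE mu (measurableC (mA n))) lte_fin => smallA.
rewrite sub0r normrN ger0_norm; last by rewrite mulr_ge0 ?word_entropy_ge0.
have [->|n0] := eqVneq n 0%N; first by rewrite invr0 mul0r ltW.
rewrite ler_pdivrMl ?ltr0n ?lt0n//.
apply: (le_trans (word_entropy_le q0 (q1 n))).
apply: (@le_trans _ _ (wsum n (fun w => e / 2 * n%:R * cylprob w +
    B * n%:R * (`[< ~ (expR (- (e / 2 * n%:R)) <= q w) >]%:R * cylprob w)))).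
  apply: ler_wsum => w wn; have m0 := cylprob_ge0 mu f p w.
  case: asboolP => /= Aw.
    rewrite mul1r -mulrDl mulrC ler_wpM2r//.
    have := q_ge w; rewrite -{1}[q w]lnK ?posrE// ler_expR wn.
    have : 0 <= e / 2 * n%:R by rewrite mulr_ge0// ltW//; lra.
    by lra.
  rewrite mul0r mulr0 addr0 mulrC ler_wpM2r//.
  by move/contrapT: Aw; rewrite -{1}[q w]lnK ?posrE// ler_expR; lra.
rewrite wsumD !wsumZ wsum_cylprob1// mulr1.
rewrite (wsum_cylprob mu measurable_f measurable_p n
  [set w | ~ (expR (- (e / 2 * n%:R)) <= q w)]).
have : B * n%:R * prob (~` A n) <= n%:R * (e / 2).
  rewrite mulrAC mulrC ler_wpM2l//.
  rewrite (le_trans (ler_wpM2r (prob_ge0 _ _) (ler_norm B)))//.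
  rewrite (le_trans (ler_wpM2l (normr_ge0 B) (ltW smallA)))//.
  by rewrite mulrCA ger_pMr ?divr_gt0// ler_pdivrMr ?mul1r ?lerDl// ltr_wpDl.
by rewrite /A; lra.
Qed.

(** Positive entropy makes some rate [c0 > 0] fast. Increasing it by steps of
    [gamma], one meets the first slow rate, by [slow_decay_large]. *)
Lemma decay_rate : 0 < entropy_of_partition mu f (fun a => p @^-1` [set a]) ->
  exists2 c0, 0 < c0 & forall gamma, 0 < gamma -> exists c, [/\ c0 <= c,
    {ae mu, forall x, fast_decay mu f p c x} &
    {ae mu, forall x, slow_decay mu f p (c + gamma) x}].
Proof.
rewrite /entropy_of_partition; under eq_fun do rewrite partition_entropy_word.
move=> ent; have [c0 c0_gt0 fast0] : exists2 c0, 0 < c0 &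
    {ae mu, forall x, fast_decay mu f p c0 x}.
  apply: contrapT => nfast.
  suff h0 : limn (fun n => n%:R^-1 * word_entropy n) = 0.
    by move: ent; rewrite h0 ltxx.
  apply: cvg_lim => //; apply: word_entropy_cvg0 => c c_gt0.
  have [//|fast] := slow_or_fast_decay measurable_f inv measurable_p erg c.
  by exfalso; apply: nfast; exists c.
exists c0 => // gamma gamma0.
have [C slowC] := slow_decay_large mu measurable_f measurable_p.
apply: contrapT => noc.
have fast k : {ae mu, forall x, fast_decay mu f p (c0 + gamma * k%:R) x}.
  elim: k => [|k IH]; first by rewrite mulr0 addr0.
  have [slow|//] := slow_or_fast_decay measurable_f inv measurable_p erg
    (c0 + gamma * k.+1%:R).
  exfalso; apply: noc; exists (c0 + gamma * k%:R); split => //.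
    by rewrite lerDl mulr_ge0// ltW.
  by have -> : c0 + gamma * k%:R + gamma = c0 + gamma * k.+1%:R;
    first by rewrite -natr1; ring.
pose k := (Num.trunc (C / gamma)).+1.
have Ck : C <= c0 + gamma * k%:R.
  have := ltW (truncnS_gt (C / gamma)).
  by rewrite ler_pdivrMr// mulrC -/k; lra.
have [x []] : exists x, slow_decay mu f p C x /\
    fast_decay mu f p (c0 + gamma * k%:R) x.
  by apply: (@ae_exists _ _ _ mu); apply: filterS2 slowC (fast k).
by move/(slow_decay_le Ck); exact: slow_fast_decay.
Qed.

End entropy.

(** * Itineraries that repeat themselves *)

Lemma exponent_balance (R : realType) (c theta g l C v n k : R) :
  0 <= g * n ->
  8 * g * n <= (c - theta * c) * n ->
  (c + 2 * g) * k <= (c + 2 * g) * (theta * n) -> g * (theta * n) <= g * n ->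
  v <= g * n -> C - l <= g * n ->
  g * n - c * n <= l + - g * k + (- ((c + 2 * g) * k) - C - (g * (n - k) + v)).
Proof. by lra. Qed.

Section repetitions.
Context {d : measure_display} {T : measurableType d} {R : realType}.
Context (mu : probability T R) (f : T -> T) (I : finType) (p : T -> I).
Hypothesis measurable_f : measurable_fun setT f.
Hypothesis inv : invariant_measure mu f.
Hypothesis erg : ergodic_measure mu f.
Hypothesis measurable_p : forall a, measurable (p @^-1` [set a]).
Local Notation word := (word f p).
Local Notation visits := (visits f).

Definition copying_weight (sigma tau : R) (a b : I) : R :=
  expR (- (if a == b then sigma else tau)).

Lemma copying_weight_subprob (sigma tau : R) a :
  expR (- sigma) + #|I|%:R * expR (- tau) <= 1 ->
  \sum_b copying_weight sigma tau a b <= 1.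
Proof.
apply: le_trans.
apply: (@le_trans _ _ (\sum_b ((a == b)%:R * expR (- sigma) + expR (- tau)))).
  apply: ler_sum => b _; rewrite /copying_weight; case: eqP => _.
    by rewrite mul1r lerDl expR_ge0.
  by rewrite mul0r add0r.
rewrite big_split/= sumr_const mulr_natl lerD2r.
rewrite (bigD1 a)//= eqxx mul1r big1 ?addr0// => b ba.
by rewrite eq_sym (negbTE ba) mul0r.
Qed.

(** Mismatches are excused by visits to [E], because closeness of two points says
    nothing about their letters when one of them lies near a boundary. *)
Definition repeats_off (E : set T) (k n : nat) (x : T) :=
  forall j, (j + k < n)%N ->
  ~ E (iter j f x) -> ~ E (iter (j + k) f x) ->
  p (iter j f x) = p (iter (j + k) f x).

(** Each visit to [E] causes at most two mismatches: at its own time, and one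
    period later. *)
Lemma follow_repeats_off (E : set T) (sigma tau : R) k l x :
  0 <= sigma -> 0 <= tau -> (0 < k)%N -> repeats_off E k (l + k) x ->
  expR (- (sigma * l%:R + tau * (visits E l x + visits E l (iter k f x))%:R)) <=
  follow (copying_weight sigma tau) (word k x) (word l (iter k f x)).
Proof.
move=> sigma0 tau0 k0; elim: l x => [|l IH] x rep.
  by rewrite /= !mulr0 addr0 oppr0 expR0.
have slide : rcons (behead (word k x)) (p (iter k f x)) = word k (f x).
  case: k k0 {IH rep} => // k _; rewrite -[in RHS](addn1 k) wordD /= cats1.
  by rewrite -iterSr.
rewrite [X in _ <= X]/= slide.
have -> : head (p (iter k f x)) (word k x) = p x by case: k k0 {IH rep slide}.
rewrite -iterS iterSr.
have {}IH := IH (f x).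
apply: (@le_trans _ _
  (expR (- (sigma + tau * (`[< E x >] + `[< E (iter k f x) >])%:R)) *
   expR (- (sigma * l%:R +
     tau * (visits E l (f x) + visits E l (iter k f (f x)))%:R)))).
  rewrite -expRD ler_expR -opprD lerN2 /= -iterS iterSr -!nat1r !natrD.
  by rewrite le_eqVlt; apply/orP; left; apply/eqP; ring.
apply: ler_pM; rewrite ?expR_ge0//; last first.
  apply: IH => j jl; rewrite -!iterSr => nE nE'.
  by have := rep j.+1; rewrite addSn; apply => //; lia.
rewrite /copying_weight ler_expR lerN2.
case: eqP => [_|neq]; first by rewrite lerDl mulr_ge0.
have [Ex|nEx] := pselect (E x).
  rewrite (asboolT Ex) natrD mulrDr mulr1.
  by have := mulr_ge0 tau0 (ler0n R (`[< E (iter k f x) >])); lra.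
have [Ekx|nEkx] := pselect (E (iter k f x)).
  rewrite (asboolT Ekx) natrD mulrDr mulr1.
  by have := mulr_ge0 tau0 (ler0n R (`[< E x >])); lra.
by exfalso; apply: neq; apply: (rep 0%N) => //; lia.
Qed.

(** Describe a word by a period [k], its first [k] letters in the code [q], and the
    mismatches with one period before. The weights [(1 - s) * s ^ k] of the
    periods sum to at most [1]. *)
Section repetition_code.
Variables (q : seq I -> R) (r : I -> I -> R) (s : R).
Hypothesis q0 : forall w, 0 <= q w.
Hypothesis q1 : forall n, wsum n q <= 1.
Hypothesis r0 : forall a b, 0 <= r a b.
Hypothesis r1 : forall a, \sum_b r a b <= 1.
Hypotheses (s_gt0 : 0 < s) (s_lt1 : s < 1).

Definition repetition_code (n : nat) (w : seq I) : R := \sum_(1 <= k < n.+1)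
  (1 - s) * s ^+ k * (q (take k w) * follow r (take k w) (drop k w)).

Let s0 k : 0 <= (1 - s) * s ^+ k.
Proof. by rewrite mulr_ge0 ?subr_ge0 ?exprn_ge0// ltW. Qed.

Lemma repetition_code_ge0 n w : 0 <= repetition_code n w.
Proof.
by apply: sumr_ge0 => k _; rewrite mulr_ge0// mulr_ge0// follow_ge0.
Qed.

Lemma wsum_repetition_code n : wsum n (repetition_code n) <= 1.
Proof.
rewrite wsum_sum.
apply: (@le_trans _ _ (\sum_(1 <= k < n.+1) (1 - s) * s ^+ k)).
  rewrite big_nat_cond [leRHS]big_nat_cond.
  apply: ler_sum => k /andP[/andP[k0 kn] _]; rewrite wsumZ ler_piMr//.
  rewrite -(subnKC (n := n) (m := k))// wsum_cat (le_trans _ (q1 k))//.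
  apply: ler_wsum => u uk.
  under eq_wsum do rewrite take_size_cat// drop_size_cat//.
  by rewrite wsumZ ler_piMr// wsum_follow// uk.
rewrite -mulr_sumr -ler_pdivlMl ?subr_gt0// mulr1.
exact: sum_geometric_le.
Qed.

Lemma repetition_code_ge k n w : (1 <= k <= n)%N ->
  (1 - s) * s ^+ k * (q (take k w) * follow r (take k w) (drop k w)) <=
  repetition_code n w.
Proof.
move=> kn; rewrite /repetition_code (bigD1_seq k) ?mem_index_iota ?iota_uniq//=.
rewrite lerDl; apply: sumr_ge0 => i _.
by rewrite mulr_ge0// mulr_ge0// follow_ge0.
Qed.

End repetition_code.

(** A repeating itinerary of length [n] has weight about [exp(- c * theta * n)] in
    the repetition code, while its cylinder has measure less than [exp(- c n)];
    this contradicts [ae_subprob_le]. All the errors are multiples of [g * n], where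
    [8 * g <= c - theta * c]. *)
Lemma ae_not_repeating (theta : R) :
  0 < entropy_of_partition mu f (fun a => p @^-1` [set a]) ->
  0 < theta -> theta < 1 -> exists2 delta : R, 0 < delta &
  forall E : set T, measurable E -> (mu E < delta%:E)%E ->
  {ae mu, forall x, \forall n \near \oo, forall k, (1 <= k)%N ->
    k%:R <= theta * n%:R -> ~ repeats_off E k n x}.
Proof.
move=> ent theta0 theta1.
have I0 : (0 < #|I|)%N by apply/card_gt0P; exists (p point).
have I1 : 1 <= #|I|%:R :> R by rewrite ler1n.
have [c0 c0_gt0 rate] := decay_rate measurable_f inv measurable_p erg ent.
have [g g0 gE] : exists2 g, 0 < g & 8 * g = c0 * (1 - theta).
  exists (c0 * (1 - theta) / 8); last by lra.
  by rewrite divr_gt0// mulr_gt0// subr_gt0.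
have [c [c0c fast slow]] := rate g g0.
have cg : 8 * g <= c - theta * c.
  have theta1' : 0 <= 1 - theta by lra.
  by rewrite gE; have := ler_wpM2r theta1' c0c; lra.
have cg_ge0 : 0 <= c + g by lra.
have cg_lt : c + g < c + 2 * g by lra.
have [q [B [q_ge q1 aeq]]] :=
  slow_decay_code measurable_f inv measurable_p erg cg_ge0 cg_lt slow.
pose s := expR (- g).
have s_gt0 : 0 < s by exact: expR_gt0.
have s_lt1 : s < 1 by rewrite expR_lt1; lra.
(* With this cost of a mismatch, [exp(- g) + #|I| * exp(- tau) = 1]. *)
pose tau := - ln ((1 - s) / #|I|%:R).
have tauE : expR (- tau) = (1 - s) / #|I|%:R.
  by rewrite opprK lnK// posrE divr_gt0//; lra.
have tau0 : 0 <= tau.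
  rewrite -oppr_le0 -(ler_expR) expR0 tauE ler_pdivrMr; lra.
exists (g / (2 * tau + 1) / 4); first by rewrite !divr_gt0//; lra.
move=> E mE muE.
have aerare := ae_rare_visits measurable_f inv erg mE muE.
have q0 w : 0 <= q w by rewrite (le_trans _ (q_ge w)) ?expR_ge0.
have r0 (a b : I) : 0 <= copying_weight g tau a b by exact: expR_ge0.
have r1 (a : I) : \sum_b copying_weight g tau a b <= 1.
  apply: copying_weight_subprob; rewrite tauE mulrCA mulfV ?mulr1; last by lra.
  by rewrite -/s; lra.
have aeQ := ae_subprob_le mu measurable_f measurable_p
  (fun n w => repetition_code_ge0 q0 r0 s_gt0 s_lt1 n w)
  (wsum_repetition_code q0 q1 r0 r1 s_gt0 s_lt1) g0.
apply: filterS (filterI (filterI fast aeq) (filterI aeQ aerare)).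
move=> x [[fastx [N _ qN]] [Qx rare]].
(* The code [q] is efficient on the words of length at least [N]; shorter words
   cost at most [B * N]. This covers bounded periods [k]. *)
pose C := `|B| * N%:R.
have C0 : 0 <= C by rewrite mulr_ge0.
have qC k : expR (- ((c + 2 * g) * k%:R) - C) <= q (word k x).
  have [Nk|kN] := leqP N k.
    by rewrite (le_trans _ (qN k Nk))// ler_expR; lra.
  rewrite (le_trans _ (q_ge _))// size_word ler_expR.
  have : B * k%:R <= C.
    rewrite (le_trans (ler_wpM2r (ler0n _ _) (ler_norm B)))//.
    by rewrite ler_wpM2l// ler_nat ltnW.
  have : 0 <= (c + 2 * g) * k%:R by rewrite mulr_ge0//; lra.
  by lra.
have large : \forall n \near \oo, C - ln (1 - s) < g * n%:R.
  exists (Num.trunc ((C - ln (1 - s)) / g)).+1 => // n /= Nn.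
  rewrite mulrC -ltr_pdivrMr// (lt_le_trans (truncnS_gt _))//.
  by rewrite ler_nat.
apply: filterS (filterI (filterI (fastx 0%N) large) (filterI Qx rare)).
move=> n [[fastn largen] [Qn raren]] k k1 kn rep.
have kn' : (k <= n)%N.
  by rewrite -(ler_nat R) (le_trans kn)// ler_piMl// ltW.
have := repetition_code_ge q0 r0 s_gt0 s_lt1 (word n x) (introT andP (conj k1 kn')).
rewrite take_word// drop_word//.
move=> /le_trans/(_ Qn); apply/negP; rewrite -ltNge.
have {}fastn : cylprob mu f p (word n x) < expR (- (c * n%:R)).
  by move: fastn => /negP; rewrite -ltNge subr0.
apply: (@lt_le_trans _ _ (expR (g * n%:R) * expR (- (c * n%:R)))).
  by rewrite ltr_pM2l ?expR_gt0.
have := @follow_repeats_off E g tau k (n - k) x (ltW g0) tau0 k1.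
rewrite subnK// => /(_ rep) fol.
apply: (@le_trans _ _ ((1 - s) * s ^+ k * (expR (- ((c + 2 * g) * k%:R) - C) *
  expR (- (g * (n - k)%:R + tau * (visits E (n - k) x +
     visits E (n - k) (iter k f x))%:R))))); last first.
  rewrite ler_wpM2l ?ler_pM ?expR_ge0//.
  by rewrite mulr_ge0 ?exprn_ge0// ltW// subr_gt0.
rewrite -{1}(lnK (x := 1 - s)) ?posrE ?subr_gt0// -expRM_natr -!expRD ler_expR.
have -> : (n - k)%:R = n%:R - k%:R :> R by rewrite natrB.
set V := (_ + _)%N.
have tauV : tau * V%:R <= g * n%:R.
  have V2 : V%:R <= 2 * (g / (2 * tau + 1) * n%:R).
    apply: (@le_trans _ _ (2 * (visits E n x)%:R)); last first.
      by rewrite ler_wpM2l// ltW.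
    rewrite mulr_natl mulr2n -natrD ler_nat leq_add// ?visits_mono ?leq_subr//.
    by rewrite -{2}(subnKC kn') visits_iter.
  rewrite (le_trans (ler_wpM2l tau0 V2))// !mulrA ler_wpM2r//.
  by rewrite ler_pdivrMr; [rewrite mulrDr mulr1; lra|lra].
have k_le : (c + 2 * g) * k%:R <= (c + 2 * g) * (theta * n%:R).
  by rewrite ler_wpM2l//; lra.
have theta_n : g * (theta * n%:R) <= g * n%:R.
  by rewrite ler_wpM2l ?(ltW g0)// ler_piMl// ltW.
have gap : 8 * g * n%:R <= (c - theta * c) * n%:R by rewrite ler_wpM2r.
exact: exponent_balance (mulr_ge0 (ltW g0) (ler0n R n)) gap k_le theta_n tauV (ltW largen).
Qed.

End repetitions.

(** * Continuity of Borel partitions off small sets *)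

Section borel_sets.
Context {R : realType} {X : pmetricType R}.

Lemma borel_ind (G : set (set X)) : (forall U, open U -> G U) ->
  (forall A, G A -> G (~` A)) ->
  (forall A : nat -> set X, (forall n, G (A n)) -> G (\bigcup_n A n)) ->
  forall A : set X, measurable (A : set (borel X)) -> G A.
Proof.
move=> Gopen GC Gcup; apply: smallest_sub => //.
split => [|A GA|//]; first by apply: Gopen; exact: open0.
by rewrite setTD; exact: GC.
Qed.

Lemma open_mball (y : X) (r : R) : open [set x | mdist y x < r].
Proof.
rewrite openE => x /= xr; rewrite /interior -nbhs_ballE.
exists (r - mdist y x) => /=; first by rewrite subr_gt0.
move=> z; rewrite ballEmdist /= ltrBrDl.
exact/le_lt_trans/metric_triangle.
Qed.

Lemma open_borel (U : set X) : open U -> measurable (U : set (borel X)).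
Proof. by move=> oU; exact: sub_sigma_algebra. Qed.

Lemma continuous_borel (f : X -> X) : continuous f ->
  measurable_fun setT (f : borel X -> borel X).
Proof.
move=> cf _ A mA; rewrite setTI; move: A mA; apply: borel_ind.
- by move=> U oU; apply: open_borel; apply: open_comp => // x _; exact: cf.
- by move=> A mA; rewrite preimage_setC; exact: measurableC.
- by move=> A mA; rewrite preimage_bigcup; exact: bigcupT_measurable.
Qed.

Variable mu : probability (borel X) R.

(** Off a set of small measure, [A] is uniformly clopen. This property is
    preserved by the Borel operations and so replaces inner regularity. *)
Definition quasi_clopen (A : set X) : Prop := forall delta : R, 0 < delta ->
  exists (E : set X) (eps : R), [/\ measurable (E : set (borel X)),
    (mu E < delta%:E)%E, 0 < eps &
    forall x y, ~ E x -> ~ E y -> mdist x y < eps -> A x -> A y].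

(** The points of [U] at distance less than [1 / (n + 1)] from the complement
    decrease to the empty set. *)
Lemma quasi_clopen_open U : open U -> quasi_clopen U.
Proof.
move=> oU delta delta0.
pose F n := U `&` \bigcup_(y in ~` U) [set x | mdist y x < n.+1%:R^-1].
have mF n : measurable (F n : set (borel X)).
  apply: open_borel; apply: openI => //; apply: bigcup_open => y _.
  exact: open_mball.
have Fcap : \bigcap_n F n = set0.
  apply/seteqP; split => // x /= Fx.
  have [Ux _] := Fx 0%N Logic.I.
  have [e /= e0 eU] : exists2 e : R, 0 < e & ball x e `<=` U.
    by move: (open_nbhs_nbhs (conj oU Ux)); rewrite -nbhs_ballE => -[e e0]; exists e.
  have [_ [y nUy yx]] := Fx (Num.trunc e^-1) Logic.I.
  apply: nUy; apply: eU; rewrite ballEmdist /= metric_sym (lt_le_trans yx)//.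
  by rewrite invf_ple ?posrE//; exact/ltW/truncnS_gt.
have : (mu \o F) @ \oo --> mu (\bigcap_n F n).
  apply: nonincreasing_cvg_mu => //.
  - by rewrite (le_lt_trans (probability_le1 _ _)) ?ltry.
  - exact: bigcapT_measurable.
  - apply/nonincreasing_seqP => n; apply/subsetPset => x [Ux [y nUy yx]].
    split => //; exists y => //; apply: lt_le_trans yx _.
    by rewrite lef_pV2 ?posrE ?ltr0n// ler_nat.
rewrite Fcap measure0 => cvgF.
have delta0' : (0 < delta%:E)%E by rewrite lte_fin.
have [N _ /(_ N (leqnn N)) FN] := cvgF _ (open_ereal_lt' delta0').
exists (F N), (N.+1%:R^-1); split => //.
move=> x y nFx _ xy Ux; apply: contrapT => nUy; apply: nFx; split => //.
by exists y => //; rewrite /= metric_sym.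
Qed.

Lemma quasi_clopenC A : quasi_clopen A -> quasi_clopen (~` A).
Proof.
move=> bA delta /bA[E [eps [mE muE eps0 EA]]]; exists E, eps; split => //.
move=> x y nEx nEy xy nAx Ay; apply: nAx; apply: (EA y x) => //.
by rewrite metric_sym.
Qed.

Lemma quasi_clopenU A B : quasi_clopen A -> quasi_clopen B ->
  quasi_clopen (A `|` B).
Proof.
move=> bA bB delta delta0; have delta2 : 0 < delta / 2 by lra.
have [E [eps [mE muE eps0 EA]]] := bA _ delta2.
have [F [eps' [mF muF eps0' FB]]] := bB _ delta2.
exists (E `|` F), (Num.min eps eps'); split.
- exact: measurableU.
- rewrite (le_lt_trans (measureU2 mu mE mF))// (splitr delta) EFinD.
  by rewrite lteD.
- by rewrite lt_min eps0 eps0'.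
move=> x y /not_orP[nEx nFx] /not_orP[nEy nFy]; rewrite lt_min => /andP[d1 d2].
by move=> [/(EA x y nEx nEy d1)|/(FB x y nFx nFy d2)]; [left|right].
Qed.

Lemma quasi_clopen_bigcup (A : nat -> set X) :
  (forall n, measurable (A n : set (borel X))) ->
  (forall n, quasi_clopen (A n)) -> quasi_clopen (\bigcup_n A n).
Proof.
move=> mA bA delta delta0; have delta2 : 0 < delta / 2 by lra.
pose B N := \big[setU/set0]_(i < N) A i.
have mB N : measurable (B N : set (borel X)) by exact: bigsetU_measurable.
have mU : measurable (\bigcup_n A n : set (borel X)) by exact: bigcupT_measurable.
have bB N : quasi_clopen (B N).
  elim: N => [|N IH]; first by rewrite /B big_ord0; apply: quasi_clopen_open; exact: open0.
  by rewrite /B big_ord_recr; exact: quasi_clopenU.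
pose D N := (\bigcup_n A n) `\` B N.
have mD N : measurable (D N : set (borel X)) by exact: measurableD.
have [N _ /(_ N (leqnn N)) DN] : \forall N \near \oo, (mu (D N) < (delta / 2)%:E)%E.
  have := @ae_eventually_small _ _ _ mu (fun N => ~` D N) (delta / 2) _ _ delta2.
  under eq_near do rewrite setCK; apply; first by move=> n; exact: measurableC.
  apply: aeW => x; have [[n _ Anx]|nx] := pselect ((\bigcup_n A n) x).
    exists n.+1 => // m /= nm [_]; apply; rewrite /B -bigcup_mkord.
    by exists n.
  by exists 0%N => // m _ [].
have [E [eps [mE muE eps0 EB]]] := bB N _ delta2.
exists (E `|` D N), eps; split => //.
- exact: measurableU.
- rewrite (le_lt_trans (measureU2 mu mE (mD N)))// (splitr delta) EFinD.
  by rewrite lteD.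
move=> x y /not_orP[nEx nDx] /not_orP[nEy _] xy Ax.
have Bx : B N x by apply: contrapT => nBx; apply: nDx.
move: (EB x y nEx nEy xy Bx); rewrite /B -bigcup_mkord => -[n _ Any].
by exists n.
Qed.

Lemma quasi_clopen_measurable A :
  measurable (A : set (borel X)) -> quasi_clopen A.
Proof.
move=> mA; suff : measurable (A : set (borel X)) /\ quasi_clopen A by case.
move: A mA; apply: borel_ind.
- by move=> U oU; split; [exact: open_borel|exact: quasi_clopen_open].
- by move=> A [mA bA]; split; [exact: measurableC|exact: quasi_clopenC].
- move=> A /all_and2[mA bA]; split; first exact: bigcupT_measurable.
  exact: quasi_clopen_bigcup.
Qed.

(** No cell needs to have a boundary of measure zero: the exceptional set [E] plays
    the part of a neighbourhood of the boundaries. *)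
Lemma locally_constant_letter (I : finType) (p : X -> I) (delta : R) :
  (forall a, measurable (p @^-1` [set a] : set (borel X))) -> 0 < delta ->
  exists (E : set X) (eps : R), [/\ measurable (E : set (borel X)),
    (mu E < delta%:E)%E, 0 < eps &
    forall x y, ~ E x -> ~ E y -> mdist x y < eps -> p x = p y].
Proof.
move=> mp.
suff : forall s : seq I, forall delta : R, 0 < delta ->
    exists (E : set X) (eps : R), [/\ measurable (E : set (borel X)),
      (mu E < delta%:E)%E, 0 < eps &
      forall x y, p x \in s -> ~ E x -> ~ E y -> mdist x y < eps -> p x = p y].
  move=> /(_ (enum I)) key /key[E [eps [mE muE eps0 Ep]]]; exists E, eps.
  by split => // x y; apply: Ep; rewrite mem_enum.
elim=> [|a s IH] {}delta delta0.
  by exists set0, 1; split => //; rewrite measure0 lte_fin.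
have delta2 : 0 < delta / 2 by lra.
have [E [eps [mE muE eps0 Es]]] := IH _ delta2.
have [F [eps' [mF muF eps0' Fa]]] := quasi_clopen_measurable (mp a) delta2.
exists (E `|` F), (Num.min eps eps'); split.
- exact: measurableU.
- rewrite (le_lt_trans (measureU2 mu mE mF))// (splitr delta) EFinD.
  by rewrite lteD.
- by rewrite lt_min eps0 eps0'.
move=> x y + /not_orP[nEx nFx] /not_orP[nEy nFy]; rewrite lt_min inE => + /andP[d1 d2].
case/orP => [/eqP pxa|xs]; last exact: Es.
by have /= -> := Fa x y nFx nFy d2 pxa.
Qed.

End borel_sets.

(** * Return times to dynamical balls *)

Section return_times.
Context {R : realType} {X : pmetricType R} (f : X -> X).

Lemma specification_return_time : specification f -> forall eps : R, 0 < eps ->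
  exists N : nat, forall x n, (min_return_time f x n eps <= (n + N)%:R%:E)%E.
Proof.
move=> spec eps /spec[N N1 specN]; exists N => x n.
have nogap i : (1 <= i < 1)%N -> (n < 0)%N /\ (N < 0 - n)%N by lia.
have [z [pz zx]] := specN 1%N (fun=> x) (fun=> 0%N) (fun=> n) (n + N)%N
  isT erefl (fun _ _ => isT) nogap (leqnn _).
apply: ereal_inf_lbound; exists (n + N)%N => //; split; first by lia.
have zB : dynamical_ball f x n eps z.
  move=> j jn; rewrite metric_sym; apply: (zx 1%N) => //.
  exact: ltnW.
by exists z; split => //=; rewrite pz.
Qed.

Lemma return_time_le x n (eps eps' : R) : eps <= eps' ->
  (min_return_time f x n eps' <= min_return_time f x n eps)%E.
Proof.
move=> ee; apply: ereal_inf_le_tmp => _ [k [k1 [y [Bky By]]] <-].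
exists k => //; split => //; exists y.
by split => j jn; rewrite (lt_le_trans _ ee)//; [exact: Bky|exact: By].
Qed.

(** If [y] and [f^k y] both follow [x], then [f^(j + k) y] is close to [f^j x] and to
    [f^(j + k) x]. *)
Lemma return_time_ge x n (eps t : R) :
  (forall k, (1 <= k)%N -> k%:R <= t ->
    ~ forall j, (j + k < n)%N -> mdist (iter j f x) (iter (j + k) f x) < eps) ->
  (t%:E <= min_return_time f x n (eps / 2))%E.
Proof.
move=> noret; apply: le_ereal_inf_tmp => _ [k [k1 [y [Bky By]]] <-].
rewrite lee_fin leNgt; apply/negP => kt; apply: (noret k k1 (ltW kt)) => j jk.
rewrite (le_lt_trans (metric_triangle _ (iter (j + k) f y) _))//.
rewrite (splitr eps) ltrD//.
  by rewrite iterD; apply: Bky; lia.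
by rewrite metric_sym; apply: By.
Qed.

End return_times.

Section limits.
Context {R : realType}.

Lemma limn_esup_near_le (u : nat -> \bar R) (l : \bar R) :
  (\forall n \near \oo, (u n <= l)%E) -> (limn_esup u <= l)%E.
Proof.
move=> ul; rewrite /limn_esup /limf_esup.
apply: (@le_trans _ _ (ereal_sup (u @` [set n | (u n <= l)%E]))).
  by apply: ereal_inf_lbound; exists [set n | (u n <= l)%E].
by apply: ge_ereal_sup => _ [n /= unl <-].
Qed.

Lemma limn_einf_near_ge (u : nat -> \bar R) (l : \bar R) :
  (\forall n \near \oo, (l <= u n)%E) -> (l <= limn_einf u)%E.
Proof.
move=> lu; rewrite /limn_einf leeNr; apply: limn_esup_near_le.
by apply: filterS lu => n; rewrite leeN2.
Qed.

Lemma cvg_right_one (g : R -> \bar R) : (forall e, 0 < e -> (g e <= 1)%E) ->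
  (forall i : nat, exists2 eps : R, 0 < eps &
    forall e, 0 < e -> e <= eps -> ((1 - i.+1%:R^-1)%:E <= g e)%E) ->
  g @ 0^'+ --> 1%E.
Proof.
move=> g1 gi A [r /= r0 rA].
have [eps eps0 geps] := gi (Num.trunc r^-1).
suff : \forall e \near 0^'+, A (g e) by [].
near=> e.
have e0 : 0 < e by near: e; exact: nbhs_right_gt.
have ee : e <= eps by near: e; exact: nbhs_right_le.
have := geps e e0 ee; have := g1 e e0.
case: (g e) => [v| |]//; rewrite !lee_fin => v1 v2.
apply: rA; rewrite /= ger0_norm ?subr_ge0//.
rewrite (@le_lt_trans _ _ ((Num.trunc r^-1).+1%:R^-1))//.
  by rewrite lerBlDr addrC -lerBlDr.
by rewrite invf_plt ?posrE// truncnS_gt.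
Unshelve. all: by end_near. Qed.

End limits.

Lemma finite_partition_letter {d : measure_display} {T : measurableType d}
    (I : finType) (P : I -> set T) : finite_partition P ->
  exists p : T -> I, P = fun a => p @^-1` [set a].
Proof.
move=> [_ tP cP].
have {cP} cP x : exists i, P i x.
  by have : [set: T] x by []; rewrite -cP => -[i _ Pix]; exists i.
exists (fun x => sval (cid (cP x))); apply/funext => a.
apply/seteqP; split => x /=; case: cid => //= i Pix; last by move=> <-.
by move=> Pax; apply: (tP i a) => //; exists x.
Qed.

Section return_rates.
Context {R : realType} {X : pmetricType R} (f : X -> X).

Lemma limn_esup_return_rate : specification f -> forall (x : X) (eps : R),
  0 < eps ->
  (limn_esup (fun n => (n%:R^-1)%:E * min_return_time f x n eps) <= 1)%E.
Proof.
move=> spec x eps /(specification_return_time spec)[N SN].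
apply/lee_addgt0Pr => e e0; apply: limn_esup_near_le.
exists (Num.trunc (N%:R / e)).+1 => // n /= nN.
have n0 : 0 < n%:R :> R by rewrite ltr0n; lia.
apply: (@le_trans _ _ ((n%:R^-1)%:E * (n + N)%:R%:E)%E).
  by rewrite lee_wpmul2l// lee_fin.
rewrite -EFinM -EFinD lee_fin ler_pdivrMl// natrD mulrDr mulr1 lerD2l.
by rewrite -ler_pdivrMr// ltW// (lt_le_trans (truncnS_gt _))// ler_nat.
Qed.

Lemma limn_einf_return_rate (x : X) (eps theta : R) :
  (\forall n \near \oo, ((theta * n%:R)%:E <= min_return_time f x n eps)%E) ->
  (theta%:E <= limn_einf (fun n => (n%:R^-1)%:E * min_return_time f x n eps))%E.
Proof.
move=> [N _ SN]; apply: limn_einf_near_ge; exists N.+1 => // n /= nN.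
have n0 : 0 < n%:R :> R by rewrite ltr0n; lia.
apply: (@le_trans _ _ ((n%:R^-1)%:E * (theta * n%:R)%:E)%E).
  by rewrite -EFinM lee_fin mulrCA mulVf ?mulr1// gt_eqF.
by rewrite lee_wpmul2l ?lee_fin ?invr_ge0// SN//= ltnW.
Qed.

Lemma ae_return_time_ge (mu : probability (borel X) R) (theta : R) :
  continuous f -> invariant_measure mu f -> ergodic_measure mu f ->
  (0 < metric_entropy mu f)%E -> 0 < theta -> theta < 1 ->
  exists2 eps : R, 0 < eps & {ae mu, forall x, \forall n \near \oo,
    ((theta * n%:R)%:E <= min_return_time f x n eps)%E}.
Proof.
move=> cf inv erg ent theta0 theta1.
have mf := continuous_borel cf.
have [h [m [P [finP hP]]] h0] := ereal_sup_gt ent.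
have [p Pp] := finite_partition_letter finP.
move: finP h0 => -[mP _ _]; rewrite hP Pp lte_fin => entp.
have mp a : measurable (p @^-1` [set a] : set (borel X)).
  by have := mP a; rewrite Pp.
have [delta delta0 norep] := ae_not_repeating mf inv erg mp entp theta0 theta1.
have [E [eps [mE muE eps0 Ep]]] := locally_constant_letter mu mp delta0.
exists (eps / 2); first by lra.
apply: filterS (norep E mE muE) => x; apply: filterS => n noret.
apply: return_time_ge => k k1 kn close; apply: (noret k k1 kn).
by move=> j jk nEj nEjk; apply: Ep => //; exact: close.
Qed.

End return_rates.

Unset Implicit Arguments.

Theorem theorem2 (R : realType) (X : pmetricType R) (f : X -> X)
    (mu : probability (borel X) R) :
  compact [set: X] ->
  continuous f ->
  specification f ->
  invariant_measure mu f ->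
  ergodic_measure mu f ->
  (0 < metric_entropy mu f)%E ->
  {ae mu, forall x : X,
    (fun eps : R => limn_esup (fun n : nat =>
       ((n%:R^-1)%:E * min_return_time f x n eps)%E)) @ 0^'+ --> 1%E /\
    (fun eps : R => limn_einf (fun n : nat =>
       ((n%:R^-1)%:E * min_return_time f x n eps)%E)) @ 0^'+ --> 1%E}.
Proof.
move=> _ cf spec inv erg ent.
pose slow (i : nat) (x : borel X) := exists2 eps : R, 0 < eps & \forall n \near \oo,
  (((1 - i.+1%:R^-1) * n%:R)%:E <= min_return_time f x n eps)%E.
have aeslow (i : nat) : {ae mu, forall x, slow i.+1 x}.
  have theta0 : 0 < 1 - i.+2%:R^-1 :> R by rewrite subr_gt0 invf_lt1// ltr1n.
  have theta1 : 1 - i.+2%:R^-1 < 1 :> R by rewrite ltrBlDr ltrDl invr_gt0.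
  have [eps eps0 aeS] := ae_return_time_ge cf inv erg ent theta0 theta1.
  apply: (@filterS _ _ (ae_filter_ringOfSetsType mu) _ _ _ aeS) => x Sx.
  by exists eps.
apply: (@filterS _ _ (ae_filter_ringOfSetsType mu) _ _ _ (ae_foralln aeslow)).
move=> x slowx.
have lower i : exists2 eps : R, 0 < eps & forall e, 0 < e -> e <= eps ->
    ((1 - i.+1%:R^-1)%:E <=
     limn_einf (fun n : nat => (n%:R^-1)%:E * min_return_time f x n e))%E.
  have [eps eps0 Sn] := slowx i; exists eps => // e e0 e_eps.
  apply: (@le_trans _ _ (1 - i.+2%:R^-1)%:E).
    by rewrite lee_fin lerB// lef_pV2 ?posrE// ler_nat.
  apply: limn_einf_return_rate; apply: filterS Sn => n /le_trans; apply.
  exact: return_time_le.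
split; apply: cvg_right_one => [e e0|i].
- exact: limn_esup_return_rate.
- have [eps eps0 le_eps] := lower i; exists eps => // e e0 e_eps.
  exact: le_trans (le_eps e e0 e_eps) (limn_einf_sup _).
- exact: le_trans (limn_einf_sup _) (limn_esup_return_rate spec x e0).
- exact: lower.
Qed.
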